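(* Consider the distributed algorithm described in the context. Assume: (1) (Bounded information) There is a constant $B>0$ such that $\max_{i}\max_{\theta',\theta''\in\Theta}\max_{x\in\mathbb{R}}\sup_{y}\left|\log\frac{f_i(y|x,\theta')}{f_i(y|x,\theta'')}\right|<B$, and for each $i\in\mathcal N$ and $\theta\in\Theta$, $f_i(y|x,\theta)$ is continuous in $x$. (2) (Network) The graph $\mathcal G$ is static, undirected and connected, and $W$ is nonnegative and doubly stochastic ($W\boldsymbol 1=\boldsymbol 1$, $\boldsymbol 1^TW=\boldsymbol 1^T$). (3) (Stepsize) $0<\alpha^{(t)}<1$ for all $t$, $\sum_{t=0}^\infty\alpha^{(t)}=\infty$ and $\sum_{t=0}^\infty(\alpha^{(t)})^2<\infty$. Then, almost surely, for every agent $i\in\mathcal N$ the belief sequence $\{q_i^{(t)}\}_{t\ge0}$ converges to a common belief $\tilde q$ given by $$\tilde q(\theta_m)=\frac{\nu_m}{\sum_{l=1}^M\nu_l},\qquad m=1,\dots,M,$$ where $\nu_m=\lim_{t\to\infty}\frac1N\sum_{i=1}^N\frac{q_i^{(t)}(\theta_m)}{q_i^{(t)}(\theta_* )}$, a limit which exists almost surely.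
   Context: Agents: $\mathcal N=\{1,\dots,N\}$. Parameter set: $\Theta=\{\theta_1,\dots,\theta_M\}$, finite; $\theta_*\in\Theta$ is the (unknown) true parameter. Agent $i$ has a cost $J_i(x,\theta)$, $x\in\mathbb{R}$, differentiable in $x$. For decision $x$ and parameter $\theta$, $f_i(\cdot|x,\theta)$ is the probability density (likelihood) of agent $i$'s noisy observation $y_i=J_i(x,\theta)+\epsilon_i$, where $\epsilon_i$ is random noise. Network: graph $\mathcal G$ on $\mathcal N$ with neighbour sets $\mathcal N_i$ and weight matrix $W=[w_{ij}]_{N\times N}$, $w_{ij}>0$ if $j\in\mathcal N_i$ and $w_{ij}=0$ otherwise. $\boldsymbol 1$ is the all-ones vector. Algorithm, with stepsizes $\alpha^{(t)}$: initial decisions $x_i^{(0)}\in\mathbb{R}$ are given, $y_i^{(0)}$ is observed at $x_i^{(0)}$, and $q_i^{(0)}(\theta_m)=1/M$ for all $i,m$. For $t=0,1,2,\dots$ and each $i\in\mathcal N$: $$b_i^{(t)}(\theta_m)=\frac{f_i(y_i^{(t)}|x_i^{(t)},\theta_m)^{\alpha^{(t)}}q_i^{(t)}(\theta_m)}{\sum_{\theta\in\Theta}f_i(y_i^{(t)}|x_i^{(t)},\theta)^{\alpha^{(t)}}q_i^{(t)}(\theta)},\qquad q_i^{(t+1)}(\theta_m)=\frac{\exp\left(\sum_{j=1}^Nw_{ij}\log b_j^{(t)}(\theta_m)\right)}{\sum_{\theta\in\Theta}\exp\left(\sum_{j=1}^Nw_{ij}\log b_j^{(t)}(\theta)\right)},$$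 $$x_i^{(t+1)}=\sum_{j=1}^Nw_{ij}\Big[x_j^{(t)}-\alpha^{(t)}\sum_{\theta\in\Theta}q_j^{(t+1)}(\theta)\nabla_xJ_j(x_j^{(t)},\theta)\Big],$$ and then the new data $y_i^{(t+1)}=J_i(x_i^{(t+1)},\theta_* )+\epsilon_i$ is observed with fresh noise; i.e. conditionally on the past (all $(x_j^{(s)},y_j^{(s)})$, $s<t$, $j\in\mathcal N$, which determine $x_i^{(t)}$), $y_i^{(t)}$ has density $f_i(\cdot|x_i^{(t)},\theta_* )$. *)

(* Defs.v *)
From HB Require Import structures.
From mathcomp Require Import all_boot all_order all_algebra.
From mathcomp Require Import all_classical all_reals all_analysis.

Set Implicit Arguments.
Unset Strict Implicit.
Unset Printing Implicit Defensive.

Import Order.TTheory GRing.Theory Num.Theory.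
Import numFieldNormedType.Exports.
Local Open Scope classical_set_scope.
Local Open Scope ring_scope.

(* The neighbour set of [i] in the graph with adjacency [e].  Neighbourhoods are
   closed, as usual for consensus weights: [i] is its own neighbour.  With open
   neighbourhoods, doubly stochastic weights on a connected bipartite graph are
   periodic (e.g. the 2 x 2 swap matrix) and need not mix. *)
Definition neighbours (N : nat) (e : rel 'I_N) (i : 'I_N) : pred 'I_N :=
  [pred j | (j == i) || e i j].

Definition undirected (N : nat) (e : rel 'I_N) : Prop := symmetric e.

Definition connected_graph (N : nat) (e : rel 'I_N) : Prop :=
  forall i j, connect e i j.

Definition graph_weights (R : realType) (N : nat) (e : rel 'I_N)
    (W : 'M[R]_N) : Prop :=
  forall i j, (j \in neighbours e i -> 0 < W i j) /\
              (j \notin neighbours e i -> W i j = 0).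

Definition doubly_stochastic (R : realType) (N : nat) (W : 'M[R]_N) : Prop :=
  [/\ forall i j, 0 <= W i j,
      W *m const_mx 1 = const_mx 1 :> 'cV[R]_N &
      const_mx 1 *m W = const_mx 1 :> 'rV[R]_N].

Definition is_density (R : realType) (g : R -> R) : Prop :=
  [/\ forall y, 0 <= g y, measurable_fun setT g &
      (\int[lebesgue_measure]_(y in setT) (g y)%:E = 1)%E].

(* Here and below [f i y x th] stands for f_i(y | x, th).
   Positivity is part of the condition because [ln] and division are total:
   without it [ln (_ / 0) = ln 0 = 0] would satisfy the bound vacuously.
   Maxima and suprema are taken jointly, in the extended reals. *)
Definition bounded_information (R : realType) (N : nat) (Theta : finType)
    (f : 'I_N -> R -> R -> Theta -> R) : Prop :=
  (forall i y x th, 0 < f i y x th) /\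
  exists B : R, 0 < B /\
    (ereal_sup [set l : \bar R | exists i th' th'' x y,
        l = (`| ln (f i y x th' / f i y x th'') |)%:E] < B%:E)%E.

(* The local Bayesian update, with the likelihood [l] tempered by [a]. *)
Definition bayes_update (R : realType) (Theta : finType)
    (a : R) (l q : Theta -> R) (th : Theta) : R :=
  (l th `^ a * q th) / \sum_th' (l th' `^ a * q th').

Definition log_average (R : realType) (N : nat) (Theta : finType)
    (w : 'I_N -> R) (b : 'I_N -> Theta -> R) (th : Theta) : R :=
  expR (\sum_j w j * ln (b j th)) /
  \sum_th' expR (\sum_j w j * ln (b j th')).

(* The pair (decisions, beliefs) of all the agents. *)
Definition agents_state (R : realType) (N : nat) (Theta : finType) : Type :=
  (('I_N -> R) * ('I_N -> Theta -> R))%type.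

Definition next_state (R : realType) (N : nat) (Theta : finType)
    (J : 'I_N -> R -> Theta -> R) (f : 'I_N -> R -> R -> Theta -> R)
    (W : 'M[R]_N) (a : R) (y : 'I_N -> R)
    (s : agents_state R N Theta) : agents_state R N Theta :=
  let x := s.1 in
  let q := s.2 in
  let b := fun i => bayes_update a (f i (y i) (x i)) (q i) in
  let q' := fun i => log_average (W i) b in
  let x' := fun i => \sum_j W i j *
    (x j - a * \sum_th q' j th * derive1 (fun z => J j z th) (x j)) in
  (x', q').

(* The state at time [t] only uses the observations [y 0], ..., [y t.-1]. *)
Fixpoint state (R : realType) (N : nat) (Theta : finType)
    (J : 'I_N -> R -> Theta -> R) (f : 'I_N -> R -> R -> Theta -> R)
    (W : 'M[R]_N) (alpha : nat -> R) (x0 : 'I_N -> R)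
    (y : nat -> 'I_N -> R) (t : nat) : agents_state R N Theta :=
  if t is t'.+1 then
    next_state J f W (alpha t') (y t') (state J f W alpha x0 y t')
  else (x0, fun _ _ => (#|Theta|%:R)^-1).

Definition decision (R : realType) (N : nat) (Theta : finType)
    (J : 'I_N -> R -> Theta -> R) (f : 'I_N -> R -> R -> Theta -> R)
    (W : 'M[R]_N) (alpha : nat -> R) (x0 : 'I_N -> R) (Omega : Type)
    (y : 'I_N -> nat -> Omega -> R) (i : 'I_N) (t : nat) (w : Omega) : R :=
  (state J f W alpha x0 (fun s j => y j s w) t).1 i.

Definition belief (R : realType) (N : nat) (Theta : finType)
    (J : 'I_N -> R -> Theta -> R) (f : 'I_N -> R -> R -> Theta -> R)
    (W : 'M[R]_N) (alpha : nat -> R) (x0 : 'I_N -> R) (Omega : Type)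
    (y : 'I_N -> nat -> Omega -> R) (i : 'I_N) (t : nat) (th : Theta)
    (w : Omega) : R :=
  (state J f W alpha x0 (fun s j => y j s w) t).2 i th.

(* The sigma-algebra generated by all (x_j^s, y_j^s) with s < t. *)
Definition past (R : realType) (N : nat) (Omega : Type)
    (x y : 'I_N -> nat -> Omega -> R) (t : nat) : set_system Omega :=
  <<s [set A | exists j s C, [/\ (s < t)%N, measurable (C : set R) &
                 A = x j s @^-1` C \/ A = y j s @^-1` C]] >>.

(* Given the sigma-algebra [F], [Y] has the (random) density [g w]: the kernel
   [C |-> \int_C g w] is a version of the conditional law of [Y]. *)
Definition has_conditional_density (R : realType) (d : measure_display)
    (Omega : measurableType d) (P : probability Omega R)
    (F : set_system Omega) (Y : Omega -> R) (g : Omega -> R -> R) : Prop :=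
  forall (A : set Omega) (C : set R), F A -> measurable C ->
    (P (A `&` Y @^-1` C) =
     \int[P]_(w in A) \int[lebesgue_measure]_(z in C) (g w z)%:E)%E.

(* The average over the agents of the belief ratios q_i(th) / q_i(th0). *)
Definition mean_belief_ratio (R : realType) (N : nat) (Theta : finType)
    (q : 'I_N -> Theta -> R) (th0 th : Theta) : R :=
  (N%:R)^-1 * \sum_i q i th / q i th0.

(* Main.v *)
(* Put Z_i(th) = ln (q_i(th) / q_i(thstar)).  One step of the algorithm is linear:
   Z_i <- sum_j w_ij (Z_j + alpha l_j), where l_j is the log-likelihood ratio of the
   new observation.  By convexity of exp and column stochasticity of W, the mean
   over i of exp Z_i is at most the mean of exp Z_j * exp (alpha l_j), and
   E[exp (alpha l_j) | past] <= 1 because r^alpha <= 1 - alpha + alpha r and the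
   likelihood ratio r has conditional mean 1.  So the mean ratio is a nonnegative
   supermartingale and converges almost surely.  Since |l_j| <= B and alpha -> 0,
   the contraction of W^N on oscillations gives Z_i - Z_j -> 0, hence every exp Z_i
   has the same limit as the mean ratio.  Normalizing gives the common belief. *)
Require Import Defs.
From HB Require Import structures.
From mathcomp Require Import all_boot all_order all_algebra.
From mathcomp Require Import all_classical all_reals all_analysis.
From mathcomp Require Import measurable_realfun ring lra.

Set Implicit Arguments.
Unset Strict Implicit.
Unset Printing Implicit Defensive.

Import Order.TTheory GRing.Theory Num.Theory.
Import numFieldNormedType.Exports.
Local Open Scope classical_set_scope.
Local Open Scope ring_scope.

(** * Doob's convergence theorem *)

(** Conditional expectations never appear. The supermartingale inequality is tested on events of the
    past, and the conditional law of an observation is given only on a past event paired with a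
    Borel set. Extending that law to joint functions of a past-measurable variable and the
    observation is thus a step of its own. It requires the decisions and beliefs to be measurable
    for the past, hence joint measurability of the likelihoods and measurability of the derivatives
    of the costs. Jensen's inequality replaces a product over the agents by a sum with one term per
    agent, so only the conditional law of each single observation enters, never their joint law. The
    limit of a ratio may be 0, and then Z_i tends to minus infinity. The agents are therefore
    compared through quotients of exponentials. The ratio at the true parameter is constantly 1,
    which keeps the limiting normalizer positive. *)

Section upcrossings.
Context {R : realType}.
Implicit Types (x : nat -> R) (a b : R).

(* The strategy that buys below [a] and sells above [b]. *)
Fixpoint holding x a b t : bool :=
  if t is t'.+1 then (if holding x a b t' then x t <= b else x t < a)
  else x 0%N < a.

Definition upcrossings x a b t : nat :=
  (\sum_(s < t) (holding x a b s && (b < x s.+1)%R))%N.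

(** A completed round trip buys below [a] and sells above [b], so it earns more than [b - a]. A
    position still open at [t] is valued as if bought at [a]; this term is negative at the moment of
    purchase, which is what makes the induction go through. *)
Lemma upcrossings_gain x a b t :
  (upcrossings x a b t)%:R * (b - a) + (if holding x a b t then x t - a else 0)
  <= \sum_(s < t) (holding x a b s)%:R * (x s.+1 - x s).
Proof.
elim: t => [|t IH].
  by rewrite /upcrossings !big_ord0 mul0r add0r /=; case: ltP => //; lra.
rewrite /upcrossings big_ord_recr [leRHS]big_ord_recr /= -/(upcrossings x a b t).
move: IH; rewrite natrD mulrDl.
set u := _%:R * (b - a); set g := \sum_(_ < _) _.
case: (holding x a b t) => /=; case: leP => xb /=; try case: ltP => xa; lra.
Qed.

(** An open position loses at most [a], since prices are nonnegative. The differences are split over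
    the two sides so that every term is nonnegative when [a <= b] and can be integrated in the
    extended reals. *)
Lemma nonneg_upcrossings_gain x a b t : (forall s, 0 <= x s) -> 0 <= a ->
  (upcrossings x a b t)%:R * (b - a) + \sum_(s < t) (holding x a b s)%:R * x s
  <= a + \sum_(s < t) (holding x a b s)%:R * x s.+1.
Proof.
move=> x0 a0; have := upcrossings_gain x a b t.
under eq_bigr do rewrite mulrBr.
rewrite sumrB; have := x0 t.
by case: ifP => _; set u := _%:R * _; set v := \sum_(_ < _) _;
  set v' := \sum_(_ < _) _; lra.
Qed.

Lemma holding_stays x a b s n : holding x a b s ->
  (forall r, (s <= r)%N -> ~~ (holding x a b r && (b < x r.+1))) ->
  holding x a b (s + n).
Proof.
move=> hs nu; elim: n => [|n IH]; first by rewrite addn0.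
have := nu _ (leq_addr n s); rewrite IH /= -leNgt => h.
by rewrite addnS /= IH.
Qed.

Lemma nondecreasing_upcrossings x a b : nondecreasing_seq (upcrossings x a b).
Proof.
by apply/nondecreasing_seqP => n; rewrite /upcrossings big_ord_recr; exact: leq_addr.
Qed.

(** The pathwise half of Doob's argument: a sequence that does not settle at its finite lower limit
    [l] crosses some band above [l] infinitely often. Rational bands suffice, so only countably many
    null sets arise later; [0 < a] costs nothing because [0 <= l]. *)
Lemma upcrossings_cvg x : (forall s, 0 <= x s) ->
  (limn_einf (EFin \o x) < +oo)%E ->
  (forall a b : rat, (0 < a)%R -> (a < b)%R ->
    exists M, forall t, (upcrossings x (ratr a) (ratr b) t <= M)%N) ->
  cvgn x.
Proof.
move=> x0 Ly U; set u := EFin \o x.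
have L0 : (0 <= limn_einf u)%E.
  rewrite limn_einf_lim; apply: lime_ge; first exact: is_cvg_einfs.
  apply: nearW => n; apply: le_ereal_inf_tmp => _ [m _ <-].
  by rewrite lee_fin x0.
have [l Ll] : exists l, limn_einf u = l%:E.
  by exists (fine (limn_einf u)); rewrite fineK// ge0_fin_numE.
have einfl : einfs u @ \oo --> l%:E.
  by rewrite -Ll limn_einf_lim; exact: is_cvg_einfs.
have freq c n : l < c -> exists2 m, (n <= m)%N & x m < c.
  move=> lc; have : (einfs u n < c%:E)%E.
    apply: (@le_lt_trans _ _ l%:E); last by rewrite lte_fin.
    rewrite -(cvg_lim _ einfl)//; apply: lime_ge.
      by apply/cvg_ex; exists l%:E.
    by near=> k; apply: nondecreasing_einfs; near: k; exact: nbhs_infty_ge.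
  by move=> /ereal_inf_lt[_ [m /= nm <-]]; rewrite lte_fin => ?; exists m.
have l0 : 0 <= l by rewrite -lee_fin -Ll.
apply/cvg_ex; exists l; apply/cvgrPdist_le => /= e e0.
have ev : \forall n \near \oo, l - e <= x n.
  have : \forall n \near \oo, ((l - e)%:E < einfs u n)%E.
    have := einfl [set y | ((l - e)%:E < y)%E]; apply.
    by apply: open_nbhs_nbhs; split; [exact: open_ereal_gt_ereal|
      rewrite /= lte_fin; lra].
  apply: filterS => n h; rewrite -lee_fin (le_trans (ltW h))//.
  by apply: ereal_inf_lbound; exists n => /=.
have ev' : \forall n \near \oo, x n <= l + e.
  (* The midpoint [l + e / 2] separates the two rationals, so that [l < a < b < l + e]. *)
  have [a la ae] : exists2 a : rat, l < ratr a & ratr a < l + e / 2.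
    have /rat_in_itvoo[a] : l < l + e / 2 by lra.
    by rewrite in_itv/= => /andP[]; exists a.
  have [b lb be] : exists2 b : rat, l + e / 2 < ratr b & ratr b < l + e.
    have /rat_in_itvoo[b] : l + e / 2 < l + e by lra.
    by rewrite in_itv/= => /andP[]; exists b.
  have ab : (a < b)%R by rewrite -(ltr_rat R); lra.
  have a0 : (0 < a)%R by rewrite -(ltr0q R); lra.
  have [M UM] := U a b a0 ab.
  apply: contrapT => nev'.
  have nev n : exists2 r, (n <= r)%N & l + e < x r.
    apply: contrapT => nr; apply: nev'; exists n => // r /= ler.
    by rewrite leNgt; apply/negP => xr; apply: nr; exists r.
  (* One more upcrossing is always available: the sequence returns below [a], so a position is open,
     and it later exceeds [l + e], hence [b], so that position must be sold. *)
  suff H k : exists t, (k <= upcrossings x (ratr a) (ratr b) t)%N.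
    by have [t] := H M.+1; rewrite leqNgt ltnS UM.
  elim: k => [|k [t kt]]; first by exists 0%N.
  have [s ts xsa] := freq (ratr a) t.+1 la.
  have hs : holding x (ratr a) (ratr b) s.
    case: s ts xsa => // s _ xsa /=; case: ifP => // _; lra.
  have [r sr xr] := nev s.+1.
  apply: contrapT => /forallNP nup.
  have nu v : (s <= v)%N ->
      ~~ (holding x (ratr a) (ratr b) v && (ratr b < x v.+1)).
    move=> sv; apply/negP => up; apply: (nup v.+1).
    rewrite /upcrossings big_ord_recr /= up addn1 ltnS -/(upcrossings _ _ _ _).
    apply: (leq_trans kt); apply: nondecreasing_upcrossings.
    exact: leq_trans (ltnW ts) sv.
  have /= := holding_stays (r.-1 - s) hs nu.
  have sr1 : (s <= r.-1)%N by case: r sr {xr} => //.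
  rewrite subnKC// => hr; have := nu _ sr1; rewrite hr /=.
  by rewrite prednK; [lra|case: r sr {xr sr1 hr}].
by near=> n; rewrite ler_distlC; apply/andP; split; near: n.
Unshelve. all: by end_near. Qed.

End upcrossings.

(** * Almost sure convergence of nonnegative supermartingales *)

Section supermartingale.
Local Open Scope ereal_scope.
Context {R : realType}.

Lemma measurable_preimage_itv d (T : measurableType d) (X : T -> R)
    (i : interval R) : measurable_fun setT X -> measurable [set w | X w \in i].
Proof.
by move=> mX; rewrite -[X in measurable X]setTI; exact: (mX measurableT [set` i]).
Qed.

Lemma measurable_holding d (T : measurableType d) (X : nat -> T -> R) (a b : R)
    t : (forall s, (s <= t)%N -> measurable_fun setT (X s)) ->
  measurable [set w | holding (X ^~ w) a b t].
Proof.
elim: t => [|t IH] mX.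
  exact: (measurable_preimage_itv `]-oo, a[ (mX _ _)).
have mH := IH (fun s st => mX s (leqW st)).
rewrite [X in measurable X](_ : _ =
    ([set w | holding (X ^~ w) a b t] `&` [set w | (X t.+1 w <= b)%R]) `|`
    (~` [set w | holding (X ^~ w) a b t] `&` [set w | (X t.+1 w < a)%R])); last first.
  apply/seteqP; split => w /=.
    by case: ifP => h; [left|right; split => //; apply/negP; rewrite h].
  by move=> [[-> //]|[/negP/negPf ->]].
apply: measurableU; apply: measurableI => //.
- exact: (measurable_preimage_itv `]-oo, b] (mX _ _)).
- exact: measurableC.
- exact: (measurable_preimage_itv `]-oo, a[ (mX _ _)).
Qed.

Context d (Omega : measurableType d) (P : probability Omega R).
Variables (G : nat -> set_system Omega) (X : nat -> Omega -> R).
Hypothesis mX : forall t, measurable_fun setT (X t).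
Hypothesis X_adapted : forall s t, (s <= t)%N ->
  measurable_fun setT (X s : g_sigma_algebraType (G t) -> R).
Hypothesis X_ge0 : forall t w, (0 <= X t w)%R.
Hypothesis X0_lty : \int[P]_w (X 0 w)%:E < +oo.
Hypothesis X_super : forall t A, <<s G t >> A ->
  \int[P]_(w in A) (X t.+1 w)%:E <= \int[P]_(w in A) (X t w)%:E.

Lemma supermartingale_integral_le t :
  \int[P]_w (X t w)%:E <= \int[P]_w (X 0 w)%:E.
Proof.
elim: t => [//|t IH]; apply: le_trans IH; apply: X_super.
exact: (@measurableT _ (g_sigma_algebraType (G t))).
Qed.

Let mXE t : measurable_fun setT (fun w => (X t w)%:E : \bar R).
Proof. exact/measurable_EFinP. Qed.

Let mH a b t : measurable [set w | holding (X ^~ w) a b t].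
Proof. by apply: measurable_holding => s _; exact: mX. Qed.

Let mHX a b s t :
  measurable_fun setT
    (fun w => ((holding (X ^~ w) a b s)%:R * X t w)%:E : \bar R).
Proof.
apply/measurable_EFinP; apply: measurable_funM => //.
rewrite (_ : (fun _ => _) = \1_[set w | holding (X ^~ w) a b s])//.
apply/funext => w; rewrite indicE; congr (nat_of_bool _)%:R.
by apply/idP/idP; rewrite inE.
Qed.

Let mU a b t : measurable_fun setT (fun w => (upcrossings (X ^~ w) a b t)%:R%:E : \bar R).
Proof.
apply/measurable_EFinP; rewrite /upcrossings.
under eq_fun do rewrite natr_sum.
apply: measurable_sum => s. 
rewrite (_ : (fun _ => _) = \1_([set w | holding (X ^~ w) a b s] `&`
    [set w | b < X s.+1 w]%R)).
  apply: measurable_indic; apply: measurableI => //.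
  rewrite [X in measurable X](_ : _ = [set w | X s.+1 w \in `]b, +oo[]).
    exact: measurable_preimage_itv.
  by apply/seteqP; split => w /=; rewrite in_itv/= andbT.
apply/funext => w; rewrite indicE; congr (nat_of_bool _)%:R.
by apply/andP/idP; rewrite inE.
Qed.

(** Doob's upcrossing inequality: whether a position is held at [s] is an event of the past at [s],
    so no expected profit is possible on the step from [s] to [s.+1]. *)
Lemma upcrossings_integral_le (a b : R) t : (0 <= a)%R -> (a <= b)%R ->
  (b - a)%:E * \int[P]_w (upcrossings (X ^~ w) a b t)%:R%:E <= a%:E.
Proof.
move=> a0 ab.
have intH s u : \int[P]_w ((holding (X ^~ w) a b s)%:R * X u w)%:E =
    \int[P]_(w in [set w | holding (X ^~ w) a b s]) (X u w)%:E.
  rewrite [RHS]integral_mkcond; apply: eq_integral => w _.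
  rewrite patchE; case: ifPn => [|/negP]; rewrite inE /=.
    by move=> ->; rewrite mul1r.
  by move=> /negP/negPf ->; rewrite mul0r.
have H0 s u w : (0 <= (holding (X ^~ w) a b s)%:R * X u w)%R.
  by rewrite mulr_ge0.
pose S u := \sum_(s < t) \int[P]_w ((holding (X ^~ w) a b s)%:R * X (u s) w)%:E.
(* Finiteness is what allows [S id] to be cancelled from both sides at the end. *)
have Sfin : S id \is a fin_num.
  rewrite ge0_fin_numE; last first.
    by apply: sume_ge0 => s _; apply: integral_ge0 => w _; rewrite lee_fin.
  apply/lte_sum_pinfty => s _.
  apply: (@le_lt_trans _ _ (\int[P]_w (X s w)%:E)).
    apply: ge0_le_integral => //; try by move=> w _; rewrite lee_fin.
    by move=> w _; rewrite lee_fin; case: holding; rewrite ?mul1r ?mul0r.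
  exact: le_lt_trans (supermartingale_integral_le s) X0_lty.
have SS : S succn <= S id.
  apply: lee_sum => s _; rewrite !intH; apply: X_super.
  apply: (@measurable_holding _ (g_sigma_algebraType (G s))) => r rs.
  exact: X_adapted.
have : (b - a)%:E * \int[P]_w (upcrossings (X ^~ w) a b t)%:R%:E + S id
    <= a%:E + S succn.
  have <- : \int[P]_w ((b - a)%:E * (upcrossings (X ^~ w) a b t)%:R%:E +
      \sum_(s < t) ((holding (X ^~ w) a b s)%:R * X s w)%:E) =
      (b - a)%:E * \int[P]_w (upcrossings (X ^~ w) a b t)%:R%:E + S id.
    rewrite ge0_integralD//.
    - rewrite ge0_integralZl//.
      + by rewrite ge0_integral_sum// => s w _; rewrite lee_fin.
      + by rewrite lee_fin subr_ge0.
    - by move=> w _; rewrite mule_ge0 ?lee_fin ?subr_ge0.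
    - exact: measurable_funeM.
    - by move=> w _; apply: sume_ge0 => s _; rewrite lee_fin.
    - exact: emeasurable_sum.
  have <- : \int[P]_w (a%:E +
      \sum_(s < t) ((holding (X ^~ w) a b s)%:R * X s.+1 w)%:E) =
      a%:E + S succn.
    rewrite ge0_integralD//.
    - rewrite ge0_integral_sum//; last by move=> s w _; rewrite lee_fin.
      by rewrite integral_cst//= probability_setT mule1.
    - by move=> w _; apply: sume_ge0 => s _; rewrite lee_fin.
    - exact: emeasurable_sum.
  apply: ge0_le_integral => //.
  - move=> w _; apply: adde_ge0; first by rewrite mule_ge0 ?lee_fin ?subr_ge0.
    by apply: sume_ge0 => s _; rewrite lee_fin.
  - apply: emeasurable_funD; first exact: measurable_funeM.
    exact: emeasurable_sum.
  - by apply: emeasurable_funD => //; exact: emeasurable_sum.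
  - move=> w _; rewrite !sumEFin -EFinM -!EFinD lee_fin [(_ * _%:R)%R]mulrC.
    exact: nonneg_upcrossings_gain.
move=> H; rewrite -(leeD2rE _ _ Sfin); apply: (le_trans H).
by rewrite leeD2l.
Qed.

(** The bound [a / (b - a)] on the expected number of upcrossings does not depend on [t], so by
    monotone convergence the total number is integrable, hence almost surely finite. *)
Lemma upcrossings_ae_bounded (a b : R) : (0 <= a)%R -> (a < b)%R ->
  {ae P, forall w, exists M, forall t, (upcrossings (X ^~ w) a b t <= M)%N}.
Proof.
move=> a0 ab.
pose U t w : \bar R := (upcrossings (X ^~ w) a b t)%:R%:E.
pose V w := limn (U ^~ w).
have ndU w : nondecreasing_seq (U ^~ w).
  by move=> m n mn; rewrite lee_fin ler_nat; exact: nondecreasing_upcrossings.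
have cU w : cvgn (U ^~ w) by exact: ereal_nondecreasing_is_cvgn.
have UV t w : U t w <= V w.
  apply: lime_ge => //; near=> n; apply: ndU; near: n.
  exact: nbhs_infty_ge.
have mV : measurable_fun setT V.
  by apply: (emeasurable_fun_cvg U) => [t|w _]; [exact: mU|exact: cU].
have V0 w : 0 <= V w by apply: le_trans (UV 0%N w); rewrite lee_fin.
have iV : P.-integrable setT V.
  apply/integrableP; split => //.
  under eq_integral do rewrite gee0_abs//.
  rewrite /V monotone_convergence//; last 2 first.
  - by move=> t; exact: mU.
  - by move=> n w _; rewrite lee_fin.
  apply: (@le_lt_trans _ _ (a / (b - a))%:E); last exact: ltry.
  apply: lime_le.
    apply: ereal_nondecreasing_is_cvgn => m n mn.
    by apply: ge0_le_integral => //; [move=> w _; rewrite lee_fin|exact: mU|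
      exact: mU|move=> w _; exact: ndU].
  apply: nearW => t; rewrite EFinM lee_pdivlMr ?subr_gt0// muleC.
  exact/upcrossings_integral_le/ltW.
have := integrable_ae measurableT iV; apply: filterS => w /(_ I) Vfin.
exists (Num.truncn (fine (V w))).+1 => t.
have := UV t w; rewrite -(fineK Vfin) lee_fin => h.
by rewrite -(ler_nat R) (le_trans h)// ltW// truncnS_gt.
Unshelve. all: by end_near. Qed.

Theorem nonneg_supermartingale_cvg : {ae P, forall w, cvgn (X ^~ w)}.
Proof.
have up : {ae P, forall w (c : rat * rat), (0 < c.1)%R -> (c.1 < c.2)%R ->
    exists M, forall t, (upcrossings (X ^~ w) (ratr c.1) (ratr c.2) t <= M)%N}.
  pose Q w (c : rat * rat) := (0 < c.1)%R -> (c.1 < c.2)%R -> exists M,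
    forall t, (upcrossings (X ^~ w) (ratr c.1) (ratr c.2) t <= M)%N.
  have : \forall w \ae P, forall n, if unpickle n is Some c then Q w c else True.
    apply: ae_foralln => n; case: unpickle => [[a b]|]; last exact: nearW.
    case: (boolP ((0 < a) && (a < b))%R) => [/andP[a0 ab]|nab].
      have : (ratr a < ratr b :> R)%R by rewrite ltr_rat.
      have : (0 <= ratr a :> R)%R by rewrite ler0q ltW.
      move=> /upcrossings_ae_bounded/[apply].
      by apply: filterS => w H _ _.
    by apply: nearW => w /= ha hb; rewrite ha hb in nab.
  by apply: filterS => w H c; have := H (pickle c); rewrite pickleK.
(* By Fatou's lemma the lower limit has integral at most that of [X 0]. *)
have fin : {ae P, forall w, limn_einf (fun t => (X t w)%:E) < +oo}.
  have mL : measurable_fun setT (fun w => limn_einf (fun t => (X t w)%:E)).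
    apply: measurableT_comp => //; apply: measurable_fun_limn_esup => t.
    exact: measurableT_comp.
  have L0 w : 0 <= limn_einf (fun t => (X t w)%:E).
    rewrite limn_einf_lim; apply: lime_ge; first exact: is_cvg_einfs.
    apply: nearW => n; apply: le_ereal_inf_tmp => _ [m _ <-].
    by rewrite lee_fin.
  have : P.-integrable setT (fun w => limn_einf (fun t => (X t w)%:E)).
    apply/integrableP; split => //.
    under eq_integral do rewrite gee0_abs//.
    have Xe0 t w : setT w -> 0 <= (X t w)%:E by rewrite lee_fin.
    apply: (le_lt_trans (fatou P measurableT mXE Xe0)).
    apply: le_lt_trans X0_lty; rewrite limn_einf_lim.
    apply: lime_le; first exact: is_cvg_einfs.
    apply: nearW => n; apply: le_trans (supermartingale_integral_le n).
    by apply: ereal_inf_lbound; exists n => /=.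
  move=> /(integrable_ae measurableT); apply: filterS => w /(_ I).
  by rewrite ge0_fin_numE.
apply: filterS2 up fin => w up fin.
by apply: upcrossings_cvg => // a b a0 ab; exact: (up (a, b)).
Qed.

End supermartingale.

(** * Integration against a conditional density *)

Section conditional_integral.
Local Open Scope ereal_scope.
Context {R : realType}.

Section ge0_measurable_ind.
Import HBNNSimple.

Lemma ge0_measurable_ind d (T : measurableType d) (Q : (T -> \bar R) -> Prop) :
  (forall D, measurable D -> Q (EFin \o \1_D)) ->
  (forall (k : R) h, (0 <= k)%R -> measurable_fun setT h ->
    (forall x, 0 <= h x) -> Q h -> Q (fun x => k%:E * h x)) ->
  (forall h1 h2, measurable_fun setT h1 -> (forall x, 0 <= h1 x) ->
    measurable_fun setT h2 -> (forall x, 0 <= h2 x) ->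
    Q h1 -> Q h2 -> Q (h1 \+ h2)) ->
  (forall h : nat -> T -> \bar R, (forall n, measurable_fun setT (h n)) ->
    (forall n x, 0 <= h n x) -> (forall x, nondecreasing_seq (h ^~ x)) ->
    (forall n, Q (h n)) -> Q (fun x => limn (h ^~ x))) ->
  forall h, measurable_fun setT h -> (forall x, 0 <= h x) -> Q h.
Proof.
move=> Q1 QZ QD Ql h mh h0.
have Qsum (s : seq R) (k : R -> R) (D : R -> set T) : (forall r, 0 <= k r)%R ->
    (forall r, measurable (D r)) ->
    Q (fun x => \sum_(r <- s) (k r)%:E * (\1_(D r) x)%:E).
  move=> k0 mD.
  have m1 r : measurable_fun setT (EFin \o \1_(D r) : T -> \bar R).
    exact/measurable_EFinP.
  elim: s => [|r s IH].
    under eq_fun do rewrite big_nil.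
    rewrite (_ : (fun _ => _) = EFin \o \1_set0); first exact: Q1.
    by apply/funext => x /=; rewrite indic0.
  under eq_fun do rewrite big_cons.
  apply: QD => //.
  - by apply: measurable_funeM; exact: m1.
  - by move=> x; rewrite mule_ge0// lee_fin.
  - by apply: emeasurable_sum => i; apply: measurable_funeM; exact: m1.
  - by move=> x; apply: sume_ge0 => i _; rewrite mule_ge0 ?lee_fin.
  - by apply: QZ => [|||]; [exact: k0|exact: m1|move=> x; rewrite lee_fin|exact: Q1].
pose h_ := nnsfun_approx measurableT mh.
have Qh n : Q (EFin \o h_ n).
  (* [Qsum] wants coefficients nonnegative for every real [r]; truncating at 0 changes nothing,
     since a negative [r] has empty preimage under a nonnegative simple function. *)
  rewrite (_ : _ \o _ = fun x => \sum_(r <- finmap.enum_fset (fset_set (range (h_ n))))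
      (Num.max r 0)%:E * (\1_(h_ n @^-1` [set r]) x)%:E).
    by apply: Qsum => // r; rewrite le_max lexx orbT.
  apply/funext => x /=; rewrite fimfunE fsbig_finite//= -sumEFin.
  apply: eq_bigr => r _; rewrite EFinM.
  have [r0|r0] := ltP r 0%R; last by [].
  by rewrite preimage_nnfun0// indic0 !mule0.
rewrite (_ : h = fun x => limn (fun n => (h_ n x)%:E)).
  apply: (Ql (fun n => EFin \o h_ n)) => // [n|n x|x m n mn].
  - exact/measurable_EFinP.
  - by rewrite lee_fin.
  - by rewrite lee_fin; exact/lefP/nd_nnsfun_approx.
by apply/funext => x; apply/esym/cvg_lim => //; exact: cvg_nnsfun_approx.
Qed.

End ge0_measurable_ind.

Context d (Omega : measurableType d) (P : probability Omega R).
Context d' (T : measurableType d').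
Variables (F : set_system Omega) (Y : Omega -> R) (xi : Omega -> T).
Variable g : T * R -> R.
Hypothesis mY : measurable_fun setT Y.
Hypothesis mxi : measurable_fun setT xi.
Hypothesis xiF : forall C, measurable C -> F (xi @^-1` C).
Hypothesis mg : measurable_fun setT g.
Hypothesis g_ge0 : forall u, (0 <= g u)%R.
Hypothesis law : has_conditional_density P F Y (fun w z => g (xi w, z)).

Local Notation mu := (@lebesgue_measure R).

Let mxiY : measurable_fun setT (fun w => (xi w, Y w)).
Proof. exact/measurable_fun_pair. Qed.

Let mhg (h : T * R -> \bar R) : measurable_fun setT h ->
  measurable_fun setT (fun u => h u * (g u)%:E).
Proof.
by move=> mh; apply: emeasurable_funM => //; exact/measurable_EFinP.
Qed.

Let mhg2 (h : T * R -> \bar R) t : measurable_fun setT h ->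
  measurable_fun setT (fun z => h (t, z) * (g (t, z))%:E).
Proof.
by move=> mh; apply: (measurableT_comp (mhg mh)); exact: measurable_pair1.
Qed.

Lemma measurable_conditional_integral (h : T * R -> \bar R) :
  measurable_fun setT h -> (forall u, 0 <= h u) ->
  measurable_fun setT (fun w => \int[mu]_z (h (xi w, z) * (g (xi w, z))%:E)).
Proof.
move=> mh h0.
have mF : measurable_fun setT (fun t => \int[mu]_z (h (t, z) * (g (t, z))%:E)).
  have hg0 u : 0 <= h u * (g u)%:E by rewrite mule_ge0 ?lee_fin.
  exact: (measurable_fun_fubini_tonelli_F (m2 := mu) _ (mhg mh) hg0).
exact: (measurableT_comp mF mxi).
Qed.

Let mhY (h : T * R -> \bar R) : measurable_fun setT h ->
  measurable_fun setT (fun w => h (xi w, Y w)).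
Proof. by move=> mh; exact: (measurableT_comp mh mxiY). Qed.

Let hg_ge0 (h : T * R -> \bar R) u : (forall u, 0 <= h u) ->
  0 <= h u * (g u)%:E.
Proof. by move=> h0; rewrite mule_ge0 ?lee_fin. Qed.

Let I_ge0 (h : T * R -> \bar R) t : (forall u, 0 <= h u) ->
  0 <= \int[mu]_z (h (t, z) * (g (t, z))%:E).
Proof. by move=> h0; apply: integral_ge0 => z _; exact: hg_ge0. Qed.

Let lhs (h : T * R -> \bar R) := \int[P]_w h (xi w, Y w).

Let rhs (h : T * R -> \bar R) :=
  \int[P]_w \int[mu]_z (h (xi w, z) * (g (xi w, z))%:E).

Let lhsD h1 h2 : measurable_fun setT h1 -> (forall u, 0 <= h1 u) ->
  measurable_fun setT h2 -> (forall u, 0 <= h2 u) ->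
  lhs (h1 \+ h2) = lhs h1 + lhs h2.
Proof.
move=> mh1 h10 mh2 h20; apply: ge0_integralD => [//|w _||w _|].
- exact: h10.
- exact: mhY.
- exact: h20.
- exact: mhY.
Qed.

Let rhsD h1 h2 : measurable_fun setT h1 -> (forall u, 0 <= h1 u) ->
  measurable_fun setT h2 -> (forall u, 0 <= h2 u) ->
  rhs (h1 \+ h2) = rhs h1 + rhs h2.
Proof.
move=> mh1 h10 mh2 h20; rewrite /rhs -ge0_integralD; first last.
- exact: measurable_conditional_integral.
- by move=> w _; exact: I_ge0.
- exact: measurable_conditional_integral.
- by move=> w _; exact: I_ge0.
- by [].
apply: eq_integral => w _; rewrite -ge0_integralD; first last.
- exact: mhg2.
- by move=> z _; exact: hg_ge0.
- exact: mhg2.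
- by move=> z _; exact: hg_ge0.
- by [].
by apply: eq_integral => z _; rewrite ge0_muleDl.
Qed.

Let lhs_lim (h : nat -> T * R -> \bar R) :
  (forall n, measurable_fun setT (h n)) -> (forall n u, 0 <= h n u) ->
  (forall u, nondecreasing_seq (h ^~ u)) ->
  lhs (fun u => limn (h ^~ u)) = limn (lhs \o h).
Proof.
move=> mh h0 nh; rewrite /lhs monotone_convergence//.
by move=> n; exact: mhY.
Qed.

Let rhs_lim (h : nat -> T * R -> \bar R) :
  (forall n, measurable_fun setT (h n)) -> (forall n u, 0 <= h n u) ->
  (forall u, nondecreasing_seq (h ^~ u)) ->
  rhs (fun u => limn (h ^~ u)) = limn (rhs \o h).
Proof.
move=> mh h0 nh.
have nhg u : nondecreasing_seq (fun n => h n u * (g u)%:E).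
  by move=> m n mn; rewrite lee_wpmul2r ?lee_fin//; exact: nh.
rewrite /comp /rhs -monotone_convergence; first last.
- move=> w _ m n mn; apply: ge0_le_integral.
  + by [].
  + by move=> z _; exact: hg_ge0.
  + exact: mhg2.
  + exact: mhg2.
  + by move=> z _; exact: nhg.
- by move=> n w _; exact: I_ge0.
- by move=> n; exact: measurable_conditional_integral.
- by [].
apply: eq_integral => w _; rewrite -monotone_convergence; first last.
- by move=> z _; exact: nhg.
- by move=> n z _; exact: hg_ge0.
- by move=> n; exact: mhg2.
- by [].
apply: eq_integral => z _; rewrite limeMr//.
exact/ereal_nondecreasing_is_cvgn/nh.
Qed.

Let m1 (E : set (T * R)) : measurable E ->
  measurable_fun setT (EFin \o \1_E : _ -> \bar R).
Proof. by move=> mE; exact/measurable_EFinP. Qed.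

Let indic_ge0 (E : set (T * R)) u : 0 <= (EFin \o \1_E) u :> \bar R.
Proof. by rewrite lee_fin. Qed.

Let indic_rectangle A B : measurable A -> measurable B ->
  lhs (EFin \o \1_(A `*` B)) = rhs (EFin \o \1_(A `*` B)).
Proof.
move=> mA mB; rewrite /lhs /rhs.
have mE : measurable (xi @^-1` A `&` Y @^-1` B).
  by apply: measurableI; rewrite -[X in measurable X]setTI;
    [exact: mxi|exact: mY].
transitivity (\int[P]_w (\1_(xi @^-1` A `&` Y @^-1` B) w)%:E).
  by apply: eq_integral => w _ /=; rewrite !indicE.
transitivity (P (xi @^-1` A `&` Y @^-1` B)).
  by rewrite (integral_indic P measurableT mE) setIT.
rewrite [LHS](law (xiF mA) mB) [LHS]integral_mkcond.
apply: eq_integral => w _; rewrite patchE; case: ifPn => [/set_mem|/negP] xA.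
  rewrite integral_mkcond; apply: eq_integral => z _.
  rewrite patchE /= indicE; case: ifPn => [|/negP] zB.
    by rewrite mem_set ?mul1e//; split => //; exact/set_mem.
  by rewrite memNset ?mul0e// => -[_ /mem_set].
rewrite integral0_eq// => z _ /=.
by rewrite indicE memNset ?mul0e// => -[/mem_set].
Qed.

Let conditional_integral_indic (D : set (T * R)) : measurable D ->
  lhs (EFin \o \1_D) = rhs (EFin \o \1_D).
Proof.
pose Phi (D : set (T * R)) := lhs (EFin \o \1_D) = rhs (EFin \o \1_D).
have PT : Phi setT by rewrite /Phi -setXTT; exact: indic_rectangle.
have LT : lhs (EFin \o \1_setT) = 1.
  rewrite -[RHS](probability_setT P) -[RHS]mul1e -integral_cst//.
  by apply: eq_integral => w _; rewrite indicT.
pose G := [set A `*` B | A in @measurable _ T & B in @measurable _ (measurableTypeR R)].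
move=> mD; suff : Phi D by [].
apply: (@dynkin_induction _ _ G Phi).
- exact: measurable_prod_measurableType.
- move=> _ _ [A mA [B mB <-]] [A' mA' [B' mB' <-]].
  rewrite -setXI; exists (A `&` A'); first exact: measurableI.
  by exists (B `&` B') => //; exact: measurableI.
- exact: PT.
- by move=> _ [A mA [B mB <-]]; exact: indic_rectangle.
- move=> S mS PS; have mCS := measurableC mS.
  have E : EFin \o \1_setT = (EFin \o \1_S) \+ (EFin \o \1_(~` S)) :> (T * R -> \bar R).
    apply/funext => u /=; rewrite !indicE in_setT in_setC -EFinD.
    by case: (u \in S); rewrite ?addr0 ?add0r.
  have lhs_ge0 D' : 0 <= lhs (EFin \o \1_D') by apply: integral_ge0 => w _.
  have lhsE := lhsD (m1 mS) (indic_ge0 S) (m1 mCS) (indic_ge0 (~` S)).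
  have rhsE := rhsD (m1 mS) (indic_ge0 S) (m1 mCS) (indic_ge0 (~` S)).
  (* Complements need a subtraction, which is legitimate because the mass of [S] is at most 1. *)
  have LS : lhs (EFin \o \1_S) \is a fin_num.
    rewrite ge0_fin_numE; last exact: lhs_ge0.
    apply: (@le_lt_trans _ _ 1); last exact: ltry.
    by rewrite -LT E lhsE leeDl; last exact: lhs_ge0.
  move: PT; rewrite /Phi E lhsE rhsE -PS => H.
  rewrite -[LHS](addeK _ LS) -[RHS](addeK _ LS); congr (_ - _).
  by rewrite addeC H addeC.
- move=> S mS tS PS; rewrite /Phi.
  have -> : EFin \o \1_(\bigcup_k S k) =
      (fun u => limn (fun n => \sum_(0 <= k < n) (EFin \o \1_(S k)) u)) :> (T * R -> \bar R).
    by apply/funext => u; rewrite /= indic_bigcup.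
  have mSn n : measurable_fun setT
      (fun u => \sum_(0 <= k < n) (EFin \o \1_(S k)) u : \bar R).
    by apply: emeasurable_sum => k; exact: (m1 (mS k)).
  have S0 n u : 0 <= \sum_(0 <= k < n) (EFin \o \1_(S k)) u :> \bar R.
    by apply: sume_ge0 => k _; exact: indic_ge0.
  rewrite lhs_lim ?rhs_lim//; first last.
  + by move=> u; apply/nondecreasing_seqP => n; rewrite big_nat_recr//= leeDl.
  + by move=> u; apply/nondecreasing_seqP => n; rewrite big_nat_recr//= leeDl.
  congr (limn _); apply/funext => n /=.
  elim: n => [|n IH].
    under eq_fun do rewrite big_geq//.
    rewrite /lhs /rhs integral0 integral0_eq// => w _.
    by rewrite integral0_eq// => z _; rewrite mul0e.
  under eq_fun do rewrite big_nat_recr//=.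
  rewrite (lhsD (mSn n) (S0 n) (m1 (mS n)) (indic_ge0 _)).
  by rewrite (rhsD (mSn n) (S0 n) (m1 (mS n)) (indic_ge0 _)) IH PS.
- by rewrite -measurable_prod_measurableType.
Qed.

(** The defining property of the conditional density is the case of rectangles. Dynkin's lemma
    extends it to all measurable sets of the product, and linearity with monotone limits to all
    nonnegative measurable functions. Here [xi] collects everything known from the past. *)
Theorem conditional_integral (h : T * R -> \bar R) :
  measurable_fun setT h -> (forall u, 0 <= h u) ->
  \int[P]_w h (xi w, Y w) =
  \int[P]_w \int[mu]_z (h (xi w, z) * (g (xi w, z))%:E).
Proof.
move: h; apply: ge0_measurable_ind.
- exact: conditional_integral_indic.
- move=> k h k0 mh h0 IH; rewrite ge0_integralZl; first last.
  + by [].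
  + by move=> w _; exact: h0.
  + exact: mhY.
  + by [].
  rewrite IH -ge0_integralZl; first last.
  + by [].
  + by move=> w _; exact: I_ge0.
  + exact: measurable_conditional_integral.
  + by [].
  apply: eq_integral => w _; rewrite -ge0_integralZl; first last.
  + by [].
  + by move=> z _; exact: hg_ge0.
  + exact: mhg2.
  + by [].
  by apply: eq_integral => z _; rewrite muleA.
- move=> h1 h2 mh1 h10 mh2 h20 IH1 IH2.
  rewrite [LHS](lhsD mh1 h10 mh2 h20) [RHS](rhsD mh1 h10 mh2 h20).
  by rewrite /lhs IH1 IH2.
- move=> h mh h0 nh IH; rewrite [LHS]lhs_lim// [RHS]rhs_lim//.
  by congr (limn _); apply/funext => n; exact: IH.
Qed.

End conditional_integral.

(** * Measurability of likelihoods, derivatives and reciprocals *)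

Section measurability.
Context {R : realType}.

(* Approximate the continuous variable from below by multiples of [1 / n.+1]. *)
Lemma measurable_fun_caratheodory d (T : measurableType d) (h : T * R -> R) :
  (forall z, measurable_fun setT (fun t => h (t, z))) ->
  (forall t, continuous (fun z => h (t, z))) ->
  measurable_fun setT h.
Proof.
move=> mh ch.
pose r n (z : R) : R := (Num.floor (n.+1%:R * z))%:~R / n.+1%:R.
apply: (measurable_fun_cvg (h := fun n u => h (u.1, r n u.2))) => [n|[t z] _].
  move=> _ C mC; rewrite setTI.
  pose cell (k : int) : set (T * R) :=
    ((fun t => h (t, k%:~R / n.+1%:R)) @^-1` C) `*`
    [set z | n.+1%:R * z \in `[k%:~R, (k + 1)%:~R[].
  have mcell k : measurable (cell k).
    apply: measurableX.
      by rewrite -[X in measurable X]setTI; exact: mh.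
    exact: measurable_preimage_itv.
  rewrite (_ : _ @^-1` _ =
      \bigcup_m (if unpickle m is Some k then cell k else set0)).
    by apply: bigcup_measurable => m _; case: unpickle.
  apply/seteqP; split => [[t z] /= Ch|[t z] [m _]].
    exists (pickle (Num.floor (n.+1%:R * z))); first by [].
    rewrite pickleK.
    by split => //=; rewrite in_itv/= floor_itv.
  case: unpickle => // k [/= Ch]; rewrite in_itv/= => zk.
  by rewrite /r (floor_def zk).
have rz : r n z @[n --> \oo] --> z.
  apply/cvgrPdist_le => /= e e0; near=> n.
  have n0 : (0 : R) < n.+1%:R by rewrite ltr0n.
  have /andP[] := floor_itv (n.+1%:R * z); rewrite intrD => h1 h2.
  have : r n z <= z by rewrite /r ler_pdivrMr// [z * _]mulrC.
  have : z <= r n z + n.+1%:R^-1.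
    by rewrite /r -[X in _ + X]mul1r -mulrDl ler_pdivlMr// [z * _]mulrC ltW.
  have : n.+1%:R^-1 <= e.
    by apply/ltW; near: n; exact: (near_infty_natSinv_lt (PosNum e0)).
  rewrite ler_distlC; move: (r n z) (n.+1%:R^-1) => u v ve zu uz.
  by apply/andP; split; lra.
exact: (cvg_comp _ _ rz (ch t z)).
Unshelve. all: by end_near. Qed.

(** The derivative need not be continuous, but it is the pointwise limit of the difference quotients
    with step [1 / n.+1]. *)
Lemma measurable_derive1 (f : R -> R) : (forall z, derivable f z 1) ->
  measurable_fun setT (derive1 f).
Proof.
move=> df.
have mf : measurable_fun setT f.
  apply: continuous_measurable_fun => z.
  exact/differentiable_continuous/derivable1_diffP.
pose h n z := n.+1%:R^-1^-1 * (f (n.+1%:R^-1 + z) - f z).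
have mh n : measurable_fun setT (h n).
  apply: measurable_funM => //; apply: measurable_funB => //.
  by apply: (measurableT_comp mf); exact: measurable_funD.
suff hf z : h ^~ z @ \oo --> derive1 f z by exact: (measurable_fun_cvg mh).
have := df z; rewrite /derivable /derive1.
under eq_fun do rewrite [_ *: 1]mulr1.
move=> dz; apply: (cvg_comp (fun n => n.+1%:R^-1) _ _ dz) => A [e /= e0 Ae].
near=> n; apply: Ae => /=; last by rewrite invr_eq0.
rewrite sub0r normrN ger0_norm//; near: n.
exact: (near_infty_natSinv_lt (PosNum e0)).
Unshelve. all: by end_near. Qed.

Lemma measurable_funV d (T : measurableType d) (h : T -> R) :
  (forall t, 0 <= h t) -> measurable_fun setT h ->
  measurable_fun setT (fun t => (h t)^-1).
Proof.
move=> h0 mh; under eq_fun do rewrite -powR_inv1//.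
exact: (measurableT_comp (measurable_powR _) mh).
Qed.

End measurability.

(** * The recursion of the algorithm *)

Section state.
Context {R : realType} (N : nat) (Theta : finType) (thstar : Theta).
Context (J : 'I_N -> R -> Theta -> R) (f : 'I_N -> R -> R -> Theta -> R).
Context (W : 'M[R]_N) (alpha : nat -> R) (x0 : 'I_N -> R).
Hypothesis f_gt0 : forall i v z th, 0 < f i v z th.

Local Notation state := (state J f W alpha x0).

Let card_Theta_gt0 : (0 < #|Theta|)%N.
Proof. by apply/card_gt0P; exists thstar. Qed.

Let sum_gt0 (u : Theta -> R) : (forall th, 0 < u th) -> 0 < \sum_th u th.
Proof.
move=> u0; rewrite (bigD1 thstar)//= ltr_wpDr//.
by apply: sumr_ge0 => th _; exact: ltW.
Qed.

Lemma bayes_update_gt0 (a : R) (l q : Theta -> R) th :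
  (forall th, 0 < l th) -> (forall th, 0 < q th) -> 0 < bayes_update a l q th.
Proof.
move=> l0 q0; have lq th' : 0 < l th' `^ a * q th' by rewrite mulr_gt0 ?powR_gt0.
by rewrite divr_gt0// sum_gt0.
Qed.

Lemma log_average_gt0 (w : 'I_N -> R) (b : 'I_N -> Theta -> R) th :
  0 < log_average w b th.
Proof. by rewrite divr_gt0 ?expR_gt0// sum_gt0// => th'; exact: expR_gt0. Qed.

Lemma sum_log_average (w : 'I_N -> R) (b : 'I_N -> Theta -> R) :
  \sum_th log_average w b th = 1.
Proof.
rewrite /log_average -mulr_suml divff// gt_eqF// sum_gt0// => th'.
exact: expR_gt0.
Qed.

Lemma ln_div_log_average (w : 'I_N -> R) (b : 'I_N -> Theta -> R) th th' :
  (forall j th, 0 < b j th) ->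
  ln (log_average w b th / log_average w b th') =
  \sum_j w j * ln (b j th / b j th').
Proof.
move=> b0; have S0 : 0 < \sum_th' expR (\sum_j w j * ln (b j th')).
  by rewrite sum_gt0// => th''; exact: expR_gt0.
rewrite /log_average invf_div mulrA mulfVK ?gt_eqF// -expRN -expRD expRK -sumrB.
by apply: eq_bigr => j _; rewrite -mulrBr ln_div// posrE b0.
Qed.

Lemma ln_div_bayes_update (a : R) (l q : Theta -> R) th th' :
  (forall th, 0 < l th) -> (forall th, 0 < q th) ->
  ln (bayes_update a l q th / bayes_update a l q th') =
  ln (q th / q th') + a * ln (l th / l th').
Proof.
move=> l0 q0; have lq0 th0 : 0 < l th0 `^ a * q th0.
  by rewrite mulr_gt0// powR_gt0.
have S0 : 0 < \sum_th' (l th' `^ a * q th') by exact: sum_gt0.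
rewrite /bayes_update invf_div mulrA mulfVK ?gt_eqF//.
rewrite !ln_div ?posrE// !lnM ?posrE ?powR_gt0// !ln_powR.
ring.
Qed.

Lemma state_belief_gt0 y t i th : 0 < (state y t).2 i th.
Proof.
by case: t => [|t] /=; [rewrite invr_gt0 ltr0n|exact: log_average_gt0].
Qed.

Lemma sum_state_belief y t i : \sum_th (state y t).2 i th = 1.
Proof.
case: t => [|t] /=; last exact: sum_log_average.
by rewrite sumr_const -[LHS]mulr_natr mulVf// pnatr_eq0 -lt0n.
Qed.

Definition log_ratio y t i th :=
  ln ((state y t).2 i th / (state y t).2 i thstar).

Lemma log_ratio0 y i th : log_ratio y 0 i th = 0.
Proof. by rewrite /log_ratio /= divff ?ln1// invr_eq0 pnatr_eq0 -lt0n. Qed.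

Lemma log_ratioS y t i th :
  log_ratio y t.+1 i th = \sum_j W i j * (log_ratio y t j th + alpha t *
    ln (f j (y t j) ((state y t).1 j) th / f j (y t j) ((state y t).1 j) thstar)).
Proof.
rewrite /log_ratio /= ln_div_log_average => [|j th']; last first.
  by apply: bayes_update_gt0 => // th''; exact: state_belief_gt0.
apply: eq_bigr => j _; rewrite ln_div_bayes_update// => th'.
exact: state_belief_gt0.
Qed.

Lemma expR_log_ratio y t i th :
  expR (log_ratio y t i th) = (state y t).2 i th / (state y t).2 i thstar.
Proof. by rewrite lnK// posrE divr_gt0// state_belief_gt0. Qed.

(** The way back from log-ratios to beliefs: since beliefs sum to 1, the sum of the ratios is the
    inverse of the belief in [thstar]. *)
Lemma belief_expR_log_ratio y t i th :
  (state y t).2 i th =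
  expR (log_ratio y t i th) / \sum_th' expR (log_ratio y t i th').
Proof.
under eq_bigr do rewrite expR_log_ratio.
rewrite -mulr_suml sum_state_belief expR_log_ratio mul1r invrK mulfVK//.
by rewrite gt_eqF// state_belief_gt0.
Qed.

Hypothesis J_diff : forall i th z, derivable (fun u => J i u th) z 1.
Hypothesis f_meas : forall i z th, measurable_fun setT (fun v => f i v z th).
Hypothesis f_cont : forall i th v, continuous (fun z => f i v z th).

Lemma measurable_likelihood i th :
  measurable_fun setT (fun u : R * R => f i u.1 u.2 th).
Proof.
apply: (measurable_fun_caratheodory (h := fun u => f i u.1 u.2 th)).
- by move=> z; exact: f_meas.
- by move=> v; exact: f_cont.
Qed.

(** The space [T] is arbitrary and only observations before [t] are required to be measurable, so
    that [T] can be taken to be [Omega] with the sigma-algebra of the past. This yields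
    adaptedness. *)
Lemma measurable_state d (T : measurableType d) (y : nat -> 'I_N -> T -> R) t :
  (forall s j, (s < t)%N -> measurable_fun setT (y s j)) ->
  (forall i, measurable_fun setT (fun w => (state (fun s j => y s j w) t).1 i)) /\
  (forall i th, measurable_fun setT (fun w => (state (fun s j => y s j w) t).2 i th)).
Proof.
elim: t => [|t IH] my; first by split=> *; exact: measurable_cst.
have {IH}[mx mq] := IH (fun s j st => my s j (ltnW st)).
have mq' i th : measurable_fun setT
    (fun w => (state (fun s j => y s j w) t.+1).2 i th).
  have mb j th' : measurable_fun setT (fun w => bayes_update (alpha t)
      (f j (y t j w) ((state (fun s j => y s j w) t).1 j))
      ((state (fun s j => y s j w) t).2 j) th').
    have ml th0 : measurable_fun setT (fun w =>
        f j (y t j w) ((state (fun s j => y s j w) t).1 j) th0 `^ alpha t *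
        (state (fun s j => y s j w) t).2 j th0).
      apply: measurable_funM => //.
      apply: (measurableT_comp (measurable_powR _)).
      have mp := measurable_fun_pair (my t j (ltnSn t)) (mx j).
      exact: (measurableT_comp (measurable_likelihood j th0) mp).
    apply: measurable_funM => //; apply: measurable_funV.
      by move=> w; apply: sumr_ge0 => th0 _; rewrite mulr_ge0 ?powR_ge0 ?ltW ?state_belief_gt0.
    exact: measurable_sum.
  have me th0 : measurable_fun setT (fun w => expR (\sum_j W i j *
      ln (bayes_update (alpha t)
      (f j (y t j w) ((state (fun s j => y s j w) t).1 j))
      ((state (fun s j => y s j w) t).2 j) th0))).
    apply: (measurableT_comp (@measurable_expR R)).
    apply: measurable_sum => j; apply: measurable_funM => //.
    exact: (measurableT_comp (@measurable_ln R)).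
  apply: measurable_funM => //; apply: measurable_funV.
    by move=> w; apply: sumr_ge0 => th0 _; exact: expR_ge0.
  exact: measurable_sum.
split=> [i|//]; apply: measurable_sum => j; apply: measurable_funM => //.
apply: measurable_funB => //; apply: measurable_funM => //.
apply: measurable_sum => th; apply: measurable_funM; first exact: mq'.
by apply: (measurableT_comp _ (mx j)); exact: measurable_derive1.
Qed.

Lemma measurable_log_ratio d (T : measurableType d) (y : nat -> 'I_N -> T -> R)
    t i th :
  (forall s j, (s < t)%N -> measurable_fun setT (y s j)) ->
  measurable_fun setT (fun w => log_ratio (fun s j => y s j w) t i th).
Proof.
move=> /measurable_state[_ mq]; apply: (measurableT_comp (@measurable_ln R)).
apply: measurable_funM => //; apply: measurable_funV => // w.
exact/ltW/state_belief_gt0.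
Qed.

End state.

(** * Consensus *)

Section consensus.
Context {R : realType} (N : nat) (e : rel 'I_N) (W : 'M[R]_N).
Hypothesis N_gt0 : (0 < N)%N.
Hypothesis e_connected : connected_graph e.
Hypothesis W_weights : graph_weights e W.
Hypothesis W_stochastic : doubly_stochastic W.

Lemma stochastic_row i : \sum_j W i j = 1.
Proof.
have [_ /matrixP/(_ i 0) + _] := W_stochastic.
by rewrite !mxE => <-; apply: eq_bigr => j _; rewrite mxE mulr1.
Qed.

Lemma stochastic_col j : \sum_i W i j = 1.
Proof.
have [_ _ /matrixP/(_ 0 j)] := W_stochastic.
by rewrite !mxE => <-; apply: eq_bigr => i _; rewrite mxE mul1r.
Qed.

Let W_ge0 i j : 0 <= W i j.
Proof. by have [] := W_stochastic. Qed.

Lemma stochastic_exp_ge0 k i j : 0 <= (W ^+ k) i j.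
Proof.
elim: k i j => [|k IH] i j; first by rewrite expr0 mxE ler0n.
by rewrite exprS mxE; apply: sumr_ge0 => l _; rewrite mulr_ge0.
Qed.

Lemma stochastic_exp_row k i : \sum_j (W ^+ k) i j = 1.
Proof.
elim: k i => [|k IH] i.
  rewrite (bigD1 i)//= big1 => [|j ji]; first by rewrite expr0 mxE eqxx addr0.
  by rewrite expr0 mxE eq_sym (negPf ji).
under eq_bigr do rewrite exprS mxE.
rewrite exchange_big /= -[RHS](stochastic_row i).
by apply: eq_bigr => l _; rewrite -mulr_sumr IH mulr1.
Qed.

Let exp_gt0S k i l j : 0 < W i l -> 0 < (W ^+ k) l j -> 0 < (W ^+ k.+1) i j.
Proof.
move=> il lj; rewrite exprS mxE (bigD1 l)//= ltr_wpDr ?mulr_gt0//.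
by apply: sumr_ge0 => m _; rewrite mulr_ge0// stochastic_exp_ge0.
Qed.

(** A duplicate-free path from [i] to [j] has fewer than [N] edges; the positive diagonal of [W]
    lets it be padded to exactly [N] steps by staying in place. *)
Lemma stochastic_exp_gt0 i j : 0 < (W ^+ N) i j.
Proof.
have edge l m : (m == l) || e l m -> 0 < W l m by have [] := W_weights l m.
have [p /shortenP[p' ep up _] jE] := connectP (e_connected i j).
have : (size p' <= N)%N.
  by apply: ltnW; have := max_card (mem (i :: p')); rewrite card_ord (card_uniqP up).
suff H n q l : path e l q -> (size q <= n)%N -> 0 < (W ^+ n) l (last l q).
  by rewrite jE; exact: H.
elim: n q l => [|n IH] [|m q] l //=.
- by rewrite expr0 mxE eqxx.
- by move=> _ _; apply: (exp_gt0S (l := l)); [rewrite edge ?eqxx|exact: (IH [::])].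
- move=> /andP[lm eq] sq; apply: (exp_gt0S (l := m)); last exact: IH.
  by rewrite edge// lm orbT.
Qed.

(** Take [delta] to be the smallest entry of [W ^+ N]. Once values are measured from their minimum
    [v k], every row puts weight at least [delta] on an entry equal to 0, so each average lies
    between 0 and [(1 - delta) * D]. *)
Lemma stochastic_exp_contraction : exists2 delta : R, 0 < delta <= 1 &
  forall (v : 'I_N -> R) (D : R), (forall i j, v i - v j <= D) ->
  forall i j, \sum_l (W ^+ N) i l * v l - \sum_l (W ^+ N) j l * v l
    <= (1 - delta) * D.
Proof.
pose i0 : 'I_N := Ordinal N_gt0.
pose F (u : 'I_N * 'I_N) := (W ^+ N) u.1 u.2.
case: (@Order.TotalTheory.arg_minP _ _ _ (i0, i0) xpredT F erefl) => -[a b] _ Fmin.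
exists (F (a, b)).
  rewrite stochastic_exp_gt0 -(stochastic_exp_row N a) (bigD1 b)//= lerDl.
  by apply: sumr_ge0 => j _; exact: stochastic_exp_ge0.
move=> v D vD i j.
case: (@Order.TotalTheory.arg_minP _ _ _ i0 xpredT v erefl) => k _ vmin.
have D0 : 0 <= D by rewrite (le_trans _ (vD i i))// subrr.
have shift m : \sum_l (W ^+ N) m l * v l =
    v k + \sum_l (W ^+ N) m l * (v l - v k).
  under [in RHS]eq_bigr do rewrite mulrBr.
  by rewrite sumrB -mulr_suml stochastic_exp_row mul1r addrC subrK.
rewrite !shift opprD addrACA subrr add0r.
have le_i : \sum_l (W ^+ N) i l * (v l - v k) <= (1 - F (a, b)) * D.
  rewrite (bigD1 k)//= subrr mulr0 add0r.
  apply: (@le_trans _ _ ((\sum_(l | l != k) (W ^+ N) i l) * D)).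
    rewrite mulr_suml; apply: ler_sum => l _.
    by rewrite ler_wpM2l// stochastic_exp_ge0.
  rewrite ler_wpM2r// -(stochastic_exp_row N i) [X in _ <= X - _](bigD1 k)//=.
  by rewrite addrAC lerDr subr_ge0; exact: (Fmin (i, k)).
rewrite (le_trans _ le_i)// gerDl oppr_le0; apply: sumr_ge0 => l _.
by rewrite mulr_ge0 ?stochastic_exp_ge0// subr_ge0 vmin.
Qed.

Section perturbed_averaging.
Variables (z u : nat -> 'I_N -> R) (c : nat -> R).
Hypothesis zS : forall t i, z t.+1 i = \sum_j W i j * (z t j + u t j).
Hypothesis u_le : forall t j, `|u t j| <= c t.
Hypothesis c_to0 : c @ \oo --> 0.

(** Averaging with row sums 1 does not increase the sup norm, so past perturbations are carried
    along without growing. *)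
Lemma perturbed_averaging_exp t k i :
  `|z (t + k) i - \sum_j (W ^+ k) i j * z t j| <= \sum_(s < k) c (t + s).
Proof.
elim: k i => [|k IH] i.
  rewrite addn0 big_ord0 (bigD1 i)//= big1 => [|j ji].
    by rewrite expr0 mxE eqxx mul1r addr0 subrr normr0.
  by rewrite expr0 mxE eq_sym (negPf ji) mul0r.
have -> : \sum_j (W ^+ k.+1) i j * z t j =
    \sum_l W i l * \sum_j (W ^+ k) l j * z t j.
  under eq_bigr do rewrite exprS mxE mulr_suml.
  rewrite exchange_big /=; apply: eq_bigr => l _.
  by rewrite mulr_sumr; apply: eq_bigr => j _; rewrite mulrA.
rewrite addnS zS -sumrB big_ord_recr /=.
apply: (le_trans (ler_norm_sum _ _ _)).
rewrite -[leRHS]mul1r -(stochastic_row i) mulr_suml.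
apply: ler_sum => l _; rewrite -mulrBr normrM ger0_norm// ler_wpM2l//.
by rewrite addrAC (le_trans (ler_normD _ _))// lerD.
Qed.

Let spread t D := forall i j, z t i - z t j <= D.

Let c_ge0 t : 0 <= c t.
Proof. exact: le_trans (u_le t (Ordinal N_gt0)). Qed.

Lemma perturbed_averaging_consensus i j : (z t i - z t j) @[t --> \oo] --> 0.
Proof.
have [delta /andP[delta0 delta1] contr] := stochastic_exp_contraction.
(* The factor 2 accounts for the two agents compared, each deviating from its [N]-step average. *)
pose rho := 1 - delta; pose E t := 2 * \sum_(s < N) c (t + s).
have spreadN t D : spread t D -> spread (t + N) (rho * D + E t).
  move=> /contr tD k l; have := tD k l.
  have := perturbed_averaging_exp t N k; have := perturbed_averaging_exp t N l.
  rewrite /E !ler_norml => /andP[+ +] /andP[].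
  set a := \sum_(_ < _) _; set b := \sum_(_ < _) _; set b' := \sum_(_ < _) _.
  rewrite /rho; move: (z _ k) (z _ l) => zk zl; lra.
have E_to0 : E @ \oo --> 0.
  have : \sum_(s < N) c (t + s) @[t --> \oo] --> \sum_(s < N) (0 : R).
    by apply: cvg_big => [|s _]; [exact: add_continuous|rewrite (cvg_shiftn s c)].
  by rewrite big1// => /(cvgMl_tmp (a := 2)); rewrite mulr0.
have [C EC] : exists C, forall t, E t <= C.
  have /cvg_seq_bounded/bounded_fun_has_ubound[C HC] : cvgn E.
    by apply/cvg_ex; exists 0.
  by exists C => t; apply: HC; exists t.
(* [M0] covers the times before a full round of [N] steps; [C / delta] is the fixed point of
   [D |-> rho * D + C], so a spread of [M] is preserved by each round. *)
pose M0 := \sum_(t < N) \sum_k \sum_l `|z t k - z t l|.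
pose M := Num.max M0 (C / delta).
have MC : C <= delta * M.
  by rewrite mulrC -ler_pdivrMr// le_max lexx orbT.
have bounded t : spread t M.
  have [n] := ubnP t; elim: n t => // n IH t tn.
  have [Nt|tN] := leqP N t.
    have tE : t = (t - N + N)%N by rewrite subnK.
    have /IH/spreadN : (t - N < n)%N.
      by rewrite -ltnS (leq_trans _ tn)// ltnS ltn_subrL N_gt0 (leq_trans N_gt0).
    rewrite -tE => tM k l; apply: le_trans (tM k l) _.
    by have := EC (t - N)%N; rewrite /rho; lra.
  move=> k l; rewrite le_max; apply/orP; left.
  apply: (le_trans (ler_norm _)).
  rewrite /M0 (bigD1 (Ordinal tN))//= (bigD1 k)//= (bigD1 l)//= -!addrA lerDl.
  rewrite !addr_ge0//; first exact: sumr_ge0.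
    by apply: sumr_ge0 => *; exact: sumr_ge0.
  by apply: sumr_ge0 => *; apply: sumr_ge0 => *; exact: sumr_ge0.
(* Instead of solving the recurrence, each further round gains a factor [rho] on the eventual bound,
   while the vanishing [E] is absorbed in an arbitrarily small [eps]. *)
have H k : forall eps, 0 < eps ->
    \forall t \near \oo, spread t (M * rho ^+ k + eps).
  elim: k => [|k IH] eps eps0.
    by apply: nearW => t a b; rewrite expr0 mulr1 (le_trans (bounded t a b))// lerDl ltW.
  have eps20 : 0 < eps / 2 by rewrite divr_gt0.
  have [T1 _ H1] := IH _ eps20.
  have [T2 _ H2] := (cvgr_lt 0 E_to0 _ eps20).
  exists (maxn T1 T2 + N)%N => // t /= tT a b.
  have Nt : (N <= t)%N by rewrite (leq_trans _ tT)// leq_addl.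
  have T12 : (maxn T1 T2 <= t - N)%N by rewrite leq_subRL// addnC.
  have := spreadN _ _ (H1 (t - N)%N (leq_trans (leq_maxl _ _) T12)) a b.
  have := H2 (t - N)%N (leq_trans (leq_maxr _ _) T12).
  rewrite /= subnK// exprS => h1 h2; apply: (le_trans h2).
  rewrite mulrDr mulrCA -addrA lerD2l.
  have : rho * (eps / 2) <= eps / 2 by rewrite ger_pMl// /rho; lra.
  by move: h1; lra.
apply/cvgrPdist_le => /= eps eps0.
have eps20 : 0 < eps / 2 by rewrite divr_gt0.
have rho1 : `|rho| < 1 by rewrite ltr_norml /rho; apply/andP; split; lra.
have : M * rho ^+ k @[k --> \oo] --> M * 0 by apply: cvgMl_tmp; exact: cvg_expr.
rewrite mulr0 => /cvgr_lt/(_ _ eps20)[k _ /(_ k (leqnn k)) /= Mk].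
apply: filterS (H k _ eps20) => t tD; rewrite sub0r normrN ler_norml.
by have := tD i j; have := tD j i; move: Mk => *; apply/andP; split; lra.
Qed.

End perturbed_averaging.
End consensus.

(** * Conditional mean of a tempered likelihood ratio *)

Section tempered_ratio.
Context {R : realType}.

(** The graph of exp lies above its tangent at the mean [m], and the linear terms average out. *)
Lemma expR_jensen (I : finType) (w a : I -> R) : (forall i, 0 <= w i) ->
  \sum_i w i = 1 -> expR (\sum_i w i * a i) <= \sum_i w i * expR (a i).
Proof.
move=> w0 w1; set m := \sum_i w i * a i.
have -> : expR m = \sum_i w i * (expR m * (1 + (a i - m))).
  under eq_bigr do rewrite mulrCA mulrDr mulr1 mulrBr.
  by rewrite -mulr_sumr big_split/= sumrB -mulr_suml w1 mul1r subrr addr0 mulr1.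
apply: ler_sum => i _; rewrite ler_wpM2l//.
rewrite -[X in _ <= expR X](subrKC m) expRD ler_wpM2l ?expR_ge0//.
exact: expR_ge1Dx.
Qed.

(** Weighted arithmetic-geometric mean inequality, as Jensen on the two points [ln (u / v)] and 0.
    The factor [v] is the density against which the ratio is integrated. *)
Lemma expR_ln_div_mul_le (a u v : R) : 0 <= a <= 1 -> 0 < u -> 0 < v ->
  expR (a * ln (u / v)) * v <= (1 - a) * v + a * u.
Proof.
move=> /andP[a0 a1] u0 v0.
have := @expR_jensen bool (fun b => if b then a else 1 - a)
  (fun b => if b then ln (u / v) else 0).
rewrite !big_bool /= mulr0 addr0 expR0 mulr1 lnK ?posrE ?divr_gt0//.
move=> H; rewrite addrC (_ : a * u + _ = (a * (u / v) + (1 - a)) * v).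
  rewrite ler_wpM2r ?(ltW v0)// H//; last by rewrite addrCA subrr addr0.
  by case; rewrite ?subr_ge0.
by rewrite [RHS]mulrDl -mulrA mulfVK// gt_eqF.
Qed.

Context d (Omega : measurableType d) (P : probability Omega R).
Variables (G : set_system Omega) (Y x V : Omega -> R) (l l' : R -> R -> R).
Hypothesis mG : G `<=` measurable.
Hypothesis mY : measurable_fun setT Y.
Hypothesis x_adapted : measurable_fun setT (x : g_sigma_algebraType G -> R).
Hypothesis V_adapted : measurable_fun setT (V : g_sigma_algebraType G -> R).
Hypothesis V_ge0 : forall w, 0 <= V w.
Hypothesis ml : measurable_fun setT (fun u : R * R => l u.1 u.2).
Hypothesis ml' : measurable_fun setT (fun u : R * R => l' u.1 u.2).
Hypothesis l_gt0 : forall v z, 0 < l v z.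
Hypothesis l'_gt0 : forall v z, 0 < l' v z.
Hypothesis l_density : forall z, is_density (l ^~ z).
Hypothesis l'_density : forall z, is_density (l' ^~ z).
Hypothesis law :
  has_conditional_density P <<s G >> Y (fun w v => l v (x w)).

Lemma sub_sigma_measurable : <<s G >> `<=` measurable.
Proof. by apply: smallest_sub => //; exact: sigma_algebra_measurable. Qed.

Lemma sub_sigma_measurable_fun d' (T : measurableType d') (h : Omega -> T) :
  measurable_fun setT (h : g_sigma_algebraType G -> T) -> measurable_fun setT h.
Proof.
by move=> mh _ C mC; apply: sub_sigma_measurable; exact: (mh measurableT C mC).
Qed.

Lemma tempered_ratio_integral_le (a : R) (A : set Omega) : 0 <= a <= 1 ->
  <<s G >> A ->
  (\int[P]_(w in A) (V w * expR (a * ln (l' (Y w) (x w) / l (Y w) (x w))))%:E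
    <= \int[P]_(w in A) (V w)%:E)%E.
Proof.
move=> a01 GA.
(* The weight [V] and the restriction to [A] are packed into the past-measurable variable, so that
   the conditional integral over all of [Omega] applies. *)
pose xi w : R * R := (V w * \1_A w, x w).
have A_adapted : measurable_fun setT (\1_A : g_sigma_algebraType G -> R).
  by apply: measurable_indic; exact: GA.
have xi_adapted : measurable_fun setT (xi : g_sigma_algebraType G -> R * R).
  exact: measurable_fun_pair (measurable_funM V_adapted A_adapted) x_adapted.
(* The absolute value makes [h] nonnegative on the whole space; on the values of [xi] it changes
   nothing. *)
pose h (u : (R * R) * R) : \bar R :=
  (`|u.1.1| * expR (a * ln (l' u.2 u.1.2 / l u.2 u.1.2)))%:E.
pose g (u : (R * R) * R) := l u.2 u.1.2.
have mswap : measurable_fun setT (fun u : (R * R) * R => (u.2, u.1.2)).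
  by apply/measurable_fun_pair => //; exact: measurableT_comp.
have mg : measurable_fun setT g by exact: (measurableT_comp ml mswap).
have mg' : measurable_fun setT (fun u : (R * R) * R => l' u.2 u.1.2).
  exact: (measurableT_comp ml' mswap).
have mh : measurable_fun setT h.
  apply/measurable_EFinP/measurable_funM.
    by apply: measurableT_comp => //; exact: measurableT_comp.
  apply: measurableT_comp => //; apply: measurable_funM => //.
  apply: (measurableT_comp (@measurable_ln R)); apply: measurable_funM => //.
  by apply: measurable_funV => // u; exact: ltW.
have h0 u : (0 <= h u)%E by rewrite lee_fin mulr_ge0 ?expR_ge0.
have xiV w : `|(xi w).1| = V w * \1_A w.
  by rewrite /= ger0_norm// mulr_ge0.
have intA (k : Omega -> R) : (\int[P]_(w in A) (k w)%:E = \int[P]_w (k w * \1_A w)%:E)%E.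
  rewrite [LHS]integral_mkcond; apply: eq_integral => w _.
  by rewrite patchE indicE; case: ifPn => _; rewrite ?mulr1 ?mulr0.
have law' : has_conditional_density P <<s G >> Y (fun w z => g (xi w, z)).
  exact: law.
have xiG C : measurable C -> <<s G >> (xi @^-1` C).
  by move=> mC; rewrite -[X in <<s _ >> X]setTI; exact: (xi_adapted measurableT).
have g0 u : 0 <= g u by exact/ltW/l_gt0.
have := conditional_integral mY (sub_sigma_measurable_fun xi_adapted) xiG mg g0
  law' mh h0.
rewrite !intA.
under eq_integral do rewrite /h /= xiV -mulrA [\1_A _ * _]mulrC mulrA.
move=> ->; apply: ge0_le_integral; first exact: measurableT.
- by move=> w _; apply: integral_ge0 => z _; rewrite mule_ge0// lee_fin.
- apply: measurable_conditional_integral mh h0 => //.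
  exact: sub_sigma_measurable_fun xi_adapted.
- apply/measurable_EFinP; apply: measurable_funM.
    exact: sub_sigma_measurable_fun.
  by apply: measurable_indic; exact: sub_sigma_measurable.
move=> w _; set v := V w * _; have v0 : 0 <= v by rewrite /v mulr_ge0.
have [l0 mlx l1] := l_density (x w); have [l'0 ml'x l'1] := l'_density (x w).
(* The mixture of the two densities has total mass 1, so [v] can be written as an integral and the
   comparison made pointwise in [z]. *)
have {l1 l'1} <- : (\int[lebesgue_measure]_z
    (v * ((1 - a) * l z (x w) + a * l' z (x w)))%:E = v%:E)%E.
  have e0 z : 0 <= (1 - a) * l z (x w) + a * l' z (x w).
    have /andP[a0 a1] := a01.
    by rewrite addr_ge0// mulr_ge0// ?subr_ge0// ltW.
  have mE (k : R -> R) : measurable_fun setT k ->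
      measurable_fun setT (fun z => (k z)%:E : \bar R).
    by move=> mk; exact/measurable_EFinP.
  have intZ (c : R) (k : R -> R) : 0 <= c -> measurable_fun setT k ->
      (forall z, 0 <= k z) -> (\int[lebesgue_measure]_z (c * k z)%:E =
        c%:E * \int[lebesgue_measure]_z (k z)%:E)%E.
    move=> c0 mk k0; under eq_integral do rewrite EFinM.
    by rewrite ge0_integralZl// => [|z _]; [exact: mE|rewrite lee_fin].
  have /andP[a0 a1] := a01.
  have mal : measurable_fun setT (fun z => (1 - a) * l z (x w)).
    exact: measurable_funM.
  have mal' : measurable_fun setT (fun z => a * l' z (x w)).
    exact: measurable_funM.
  rewrite intZ//; last exact: measurable_funD.
  under eq_integral do rewrite EFinD.
  rewrite ge0_integralD//; first last.
  - exact: mE.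
  - by move=> z _; rewrite lee_fin mulr_ge0.
  - exact: mE.
  - by move=> z _; rewrite lee_fin mulr_ge0// subr_ge0.
  by rewrite !intZ ?subr_ge0// l1 l'1 !mule1 -EFinD subrK mule1.
have mhz : measurable_fun setT (fun z => h (xi w, z)).
  by apply: (measurableT_comp mh); exact: measurable_pair1.
have mgz : measurable_fun setT (fun z => g (xi w, z)).
  by apply: (measurableT_comp mg); exact: measurable_pair1.
apply: ge0_le_integral; first exact: measurableT.
- by move=> z _; rewrite mule_ge0// lee_fin.
- by apply: emeasurable_funM => //; exact/measurable_EFinP.
- apply/measurable_EFinP; apply: measurable_funM => //.
  by apply: measurable_funD; apply: measurable_funM.
move=> z _; rewrite -EFinM lee_fin xiV -mulrA ler_wpM2l//.
exact: expR_ln_div_mul_le.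
Qed.

End tempered_ratio.

(** * Convergence of the beliefs *)

Section belief_ratio.
Context {R : realType} (N : nat) (Theta : finType) (thstar : Theta).
Context (J : 'I_N -> R -> Theta -> R) (f : 'I_N -> R -> R -> Theta -> R).
Context (W : 'M[R]_N) (alpha : nat -> R) (x0 : 'I_N -> R).
Hypothesis N_gt0 : (0 < N)%N.
Hypothesis f_gt0 : forall i v z th, 0 < f i v z th.
Hypothesis W_stochastic : doubly_stochastic W.

Local Notation Z := (log_ratio thstar J f W alpha x0).
Local Notation agents := (state J f W alpha x0).

Definition mean_ratio y t th := N%:R^-1 * \sum_i expR (Z y t i th).

Lemma mean_ratio_ge0 y t th : 0 <= mean_ratio y t th.
Proof.
by rewrite mulr_ge0// ?invr_ge0//; apply: sumr_ge0 => i _; exact: expR_ge0.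
Qed.

Lemma mean_ratio_thstar y t : mean_ratio y t thstar = 1.
Proof.
rewrite /mean_ratio (eq_bigr (fun=> 1)) => [|i _]; last first.
  by rewrite expR_log_ratio// divff// gt_eqF// state_belief_gt0.
by rewrite sumr_const card_ord mulVf// pnatr_eq0 -lt0n.
Qed.

Lemma mean_ratio0 y th : mean_ratio y 0 th = 1.
Proof.
rewrite /mean_ratio (eq_bigr (fun=> 1)) => [|i _]; last first.
  by rewrite log_ratio0 expR0.
by rewrite sumr_const card_ord mulVf// pnatr_eq0 -lt0n.
Qed.

(* Jensen's inequality through [W], whose column sums are 1: this makes the mean
   ratio a supermartingale. *)
Lemma mean_ratioS_le y t th : mean_ratio y t.+1 th <=
  N%:R^-1 * \sum_j expR (Z y t j th) * expR (alpha t *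
    ln (f j (y t j) ((agents y t).1 j) th /
        f j (y t j) ((agents y t).1 j) thstar)).
Proof.
rewrite /mean_ratio ler_wpM2l ?invr_ge0//.
have W0 i j : 0 <= W i j by have [] := W_stochastic.
under eq_bigr do rewrite log_ratioS//.
apply: (le_trans (ler_sum _ _)) => [i _|].
  by apply: expR_jensen => //; exact: (stochastic_row W_stochastic).
rewrite exchange_big /=; apply: ler_sum => j _.
by rewrite -mulr_suml (stochastic_col W_stochastic) mul1r expRD.
Qed.

(** The mean ratio divided by [expR (Z y t i th)] is the mean of the exponentials of [Z_j - Z_i],
    hence tends to 1. This gives the limit of each agent's ratio even when [nu th] is 0. *)
Lemma cvg_belief y (nu : Theta -> R) i :
  (forall th, mean_ratio y t th @[t --> \oo] --> nu th) ->
  (forall j th, (Z y t j th - Z y t i th) @[t --> \oo] --> 0) ->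
  forall th, (agents y t).2 i th @[t --> \oo] --> nu th / \sum_l nu l.
Proof.
move=> cnu cons.
have nu0 th : 0 <= nu th.
  have h := cnu th; rewrite -(cvg_lim _ h)//; apply: limr_ge.
    by apply/cvg_ex; exists (nu th).
  by apply: nearW => t; exact: mean_ratio_ge0.
have nu1 : nu thstar = 1.
  have h := cnu thstar; rewrite -(cvg_lim _ h)//; apply/cvg_lim => //.
  by under eq_fun do rewrite mean_ratio_thstar; exact: cvg_cst.
have S0 : \sum_l nu l != 0.
  rewrite gt_eqF// (bigD1 thstar)//= nu1 ltr_wpDr//.
  exact: sumr_ge0.
have cexp th : expR (Z y t i th) @[t --> \oo] --> nu th.
  have cr : mean_ratio y t th / expR (Z y t i th) @[t --> \oo] --> (1 : R).
    have -> : (1 : R) = N%:R^-1 * \sum_(j < N) expR 0.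
      rewrite expR0 sumr_const card_ord mulVf// pnatr_eq0 -lt0n//.
    under eq_fun do rewrite /mean_ratio -mulrA mulr_suml.
    apply: cvgMl_tmp; apply: cvg_big => [|j _]; first exact: add_continuous.
    under eq_fun do rewrite -expRN -expRD.
    apply: continuous_cvg; [exact: continuous_expR|exact: cons].
  have -> : nu th = nu th * 1^-1 by rewrite invr1 mulr1.
  rewrite (_ : (fun t => _) = (fun t => mean_ratio y t th *
      (mean_ratio y t th / expR (Z y t i th))^-1)).
    by apply: cvgM (cnu th) _; apply: cvgV => //; exact: oner_neq0.
  apply/funext => t; rewrite invf_div mulrCA divff ?mulr1//.
  rewrite gt_eqF// mulr_gt0 ?invr_gt0 ?ltr0n//.
  rewrite (bigD1 i)//= ltr_wpDr ?expR_gt0//.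
  by apply: sumr_ge0 => j _; exact: expR_ge0.
move=> th; under eq_fun do rewrite (belief_expR_log_ratio thstar)//.
apply: cvgM => //; apply: cvgV => //.
by apply: cvg_big => [|l _]; [exact: add_continuous|exact: cexp].
Qed.

End belief_ratio.

(** * Convergence to a common belief *)

Theorem theorem1 (R : realType) (N : nat) (hN : (0 < N)%N)
  (Theta : finType) (thstar : Theta)
  (J : 'I_N -> R -> Theta -> R) (f : 'I_N -> R -> R -> Theta -> R)
  (e : rel 'I_N) (W : 'M[R]_N) (alpha : nat -> R) (x0 : 'I_N -> R)
  (d : measure_display) (Omega : measurableType d) (P : probability Omega R)
  (eps y : 'I_N -> nat -> {RV P >-> R})
  (x := decision J f W alpha x0 y) (q := belief J f W alpha x0 y)
  (J_diff : forall i th z, derivable (fun u => J i u th) z 1)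
  (f_density : forall i z th, is_density (fun v => f i v z th))
  (f_bounded : bounded_information f)
  (f_cont : forall i th v, continuous (fun z => f i v z th))
  (e_undirected : undirected e) (e_connected : connected_graph e)
  (W_weights : graph_weights e W) (W_stochastic : doubly_stochastic W)
  (alpha_bounds : forall t, 0 < alpha t < 1)
  (alpha_sum : series alpha @ \oo --> +oo)
  (alpha_sum2 : cvgn (series (fun t => alpha t ^+ 2)))
  (y_noise : forall i t w, y i t w = J i (x i t w) thstar + eps i t w)
  (y_law : forall i t,
    has_conditional_density P (past x y t) (y i t)
      (fun w v => f i v (x i t w) thstar)) :
  {ae P, forall w,
    let ratio th t := mean_belief_ratio (fun i th' => q i t th' w) thstar th in
    let nu th := limn (ratio th) in
    (forall th, cvgn (ratio th)) /\
    (forall i th, (fun t => q i t th w) @ \oo --> nu th / \sum_l nu l)}.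
Proof.
case: f_bounded => f_gt0 [B [B0 supB]].
have lnB i th th' v z : `|ln (f i v z th / f i v z th')| <= B.
  rewrite -lee_fin; apply: le_trans (ltW supB); apply: ereal_sup_ubound.
  by exists i, th, th', z, v.
have f_meas i z th : measurable_fun setT (fun v => f i v z th).
  by have [] := f_density i z th.
have mf i th := @measurable_likelihood R N Theta f f_meas f_cont i th.
pose obs w : nat -> 'I_N -> R := fun s j => y j s w.
pose Z t i th w := log_ratio thstar J f W alpha x0 (obs w) t i th.
pose X th t w := mean_ratio thstar J f W alpha x0 (obs w) t th.
have ratioE th w : (fun t => mean_belief_ratio (fun i th' => q i t th' w) thstar th) =
    X th ^~ w.
  apply/funext => t; rewrite /mean_belief_ratio /X /mean_ratio; congr (_ * _).
  by apply: eq_bigr => i _; rewrite expR_log_ratio.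
(* The generators of [past x y t], named separately because [g_sigma_algebraType] takes a generating
   family. *)
pose G t := [set A | exists j s C, [/\ (s < t)%N, measurable (C : set R) &
  A = x j s @^-1` C \/ A = y j s @^-1` C]].
have y_adapted s j t : (s < t)%N ->
    measurable_fun setT (y j s : g_sigma_algebraType (G t) -> R).
  move=> st _ C mC; rewrite setTI; apply: sub_sigma_algebra.
  by exists j, s, C; split => //; right.
have mx t i : measurable_fun setT (x i t).
  have [+ _] := @measurable_state R N Theta thstar J f W alpha x0 J_diff
    f_meas f_cont _ Omega (fun s j => y j s) t
    (fun s j _ => measurable_funP (y j s)).
  exact.
have GM t : G t `<=` measurable.
  move=> _ [j [s [C [_ mC [->|->]]]]]; rewrite -[X in measurable X]setTI.
    exact: mx.
  exact: (measurable_funP (y j s)).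
(* The case [s = t] is included although the generators stop before [t]: the recursion computes the
   decision at [t] from earlier observations. *)
have x_adapted s t i : (s <= t)%N ->
    measurable_fun setT (x i s : g_sigma_algebraType (G t) -> R).
  move=> st.
  have [+ _] := @measurable_state R N Theta thstar J f W alpha x0 J_diff
    f_meas f_cont _ (g_sigma_algebraType (G t)) (fun s j => y j s) s
    (fun r j rs => y_adapted r j t (leq_trans rs st)).
  exact.
have Z_adapted s t i th : (s <= t)%N ->
    measurable_fun setT (Z s i th : g_sigma_algebraType (G t) -> R).
  move=> st.
  exact: (@measurable_log_ratio R N Theta thstar J f W alpha x0 J_diff
    f_meas f_cont _ (g_sigma_algebraType (G t)) (fun s j => y j s) s i th
    (fun r j rs => y_adapted r j t (leq_trans rs st))).
have expZ_adapted s t i th : (s <= t)%N ->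
    measurable_fun setT
      ((fun w => expR (Z s i th w)) : g_sigma_algebraType (G t) -> R).
  by move=> st; exact: (measurableT_comp (@measurable_expR R) (Z_adapted _ _ _ _ st)).
have X_adapted th s t : (s <= t)%N ->
    measurable_fun setT (X th s : g_sigma_algebraType (G t) -> R).
  move=> st; apply: measurable_funM => //; apply: measurable_sum => i.
  exact: expZ_adapted.
have mX th t : measurable_fun setT (X th t).
  exact: (sub_sigma_measurable_fun (GM t) (X_adapted th t t (leqnn t))).
have X0 th t w : 0 <= X th t w by exact: mean_ratio_ge0.
have mexpZ t i th : measurable_fun setT (fun w => expR (Z t i th w)).
  exact: (sub_sigma_measurable_fun (GM t) (expZ_adapted t t i th (leqnn t))).
pose r t j th w := f j (y j t w) (x j t w) th / f j (y j t w) (x j t w) thstar.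
have mr t j th : measurable_fun setT (r t j th).
  have mp := measurable_fun_pair (measurable_funP (y j t)) (mx t j).
  apply: measurable_funM; first exact: (measurableT_comp (mf j th) mp).
  apply: measurable_funV => [w|]; first exact: ltW.
  exact: (measurableT_comp (mf j thstar) mp).
have X_super th t A : <<s G t >> A ->
    (\int[P]_(w in A) (X th t.+1 w)%:E <= \int[P]_(w in A) (X th t w)%:E)%E.
  move=> GA; have mA := sub_sigma_measurable (GM t) GA.
  have intS (k : 'I_N -> Omega -> R) : (forall j, measurable_fun setT (k j)) ->
      (forall j w, 0 <= k j w) ->
      (\int[P]_(w in A) (N%:R^-1 * \sum_j k j w)%:E =
       N%:R^-1%:E * \sum_j \int[P]_(w in A) (k j w)%:E)%E.
    move=> mk k0; have mkE j : measurable_fun A (fun w => (k j w)%:E : \bar R).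
      by apply: measurable_funTS; exact/measurable_EFinP.
    under eq_integral do rewrite EFinM -sumEFin.
    rewrite ge0_integralZl; first last.
    - by rewrite lee_fin invr_ge0.
    - by move=> w _; apply: sume_ge0 => j _; rewrite lee_fin.
    - by apply: emeasurable_sum => j; exact: mkE.
    - exact: mA.
    by rewrite ge0_integral_sum// => j w _; rewrite lee_fin.
  pose k j w := expR (Z t j th w) * expR (alpha t * ln (r t j th w)).
  have mk j : measurable_fun setT (k j).
    apply: measurable_funM => //; apply: (measurableT_comp (@measurable_expR R)).
    by apply: measurable_funM => //; exact: (measurableT_comp (@measurable_ln R)).
  have k0 j w : 0 <= k j w by rewrite mulr_ge0// expR_ge0.
  apply: (@le_trans _ _ (\int[P]_(w in A) (N%:R^-1 * \sum_j k j w)%:E)%E).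
    apply: ge0_le_integral => //.
    - by move=> w _; rewrite lee_fin.
    - by apply: measurable_funTS; exact/measurable_EFinP.
    - apply: measurable_funTS; apply/measurable_EFinP.
      by apply: measurable_funM => //; exact: measurable_sum.
    - by move=> w _; rewrite lee_fin; exact: mean_ratioS_le.
  have -> := intS (fun j w => expR (Z t j th w)) (fun j => mexpZ t j th)
    (fun j w => expR_ge0 _).
  rewrite intS//.
  rewrite lee_wpmul2l ?lee_fin ?invr_ge0//; apply: lee_sum => j _.
  apply: (@tempered_ratio_integral_le R _ Omega P (G t) (y j t) (x j t)
    (fun w => expR (Z t j th w)) (fun v z => f j v z thstar)
    (fun v z => f j v z th)) => //.
  - exact: x_adapted.
  - exact: expZ_adapted.
  - exact: y_law.
  - by have /andP[a0 a1] := alpha_bounds t; rewrite !ltW.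
have X_cvg : \forall w \ae P, forall th, cvgn (X th ^~ w).
  apply: filter_forall => th; apply: (nonneg_supermartingale_cvg (G := G)).
  - exact: mX.
  - by move=> s t st; exact: X_adapted.
  - exact: X0.
  - rewrite (eq_integral (cst 1%E)) => [|w _]; last first.
      by rewrite /X mean_ratio0.
    by rewrite integral_cst//= probability_setT mule1 ltry.
  - exact: X_super.
(* From here on the argument is pathwise: consensus holds for every [w], and only the convergence of
   the mean ratios is almost sure. *)
apply: filterS X_cvg => w X_cvg /=; split => [th|i th].
  by rewrite ratioE; exact: X_cvg.
suff : (fun t => q i t th w) @ \oo --> limn (X th ^~ w) / \sum_l limn (X l ^~ w).
  by rewrite ratioE; under [in X in _ -> X]eq_bigr do rewrite ratioE.
(* The terms of the convergent series of squares tend to 0; take square roots. *)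
have alpha0 : alpha @ \oo --> 0.
  rewrite -(sqrtr0 R) (_ : alpha = fun t => Num.sqrt (alpha t ^+ 2)).
    apply: continuous_cvg; first exact: sqrt_continuous.
    exact: cvg_series_cvg_0 alpha_sum2.
  apply/funext => t; have /andP[a0 _] := alpha_bounds t.
  by rewrite sqrtr_sqr gtr0_norm.
have cons j th' : (Z t j th' w - Z t i th' w) @[t --> \oo] --> 0.
  apply: (perturbed_averaging_consensus hN e_connected W_weights W_stochastic
    (z := fun t j => Z t j th' w)
    (u := fun t j => alpha t * ln (r t j th' w)) (c := fun t => alpha t * B)).
  - by move=> t k; exact: log_ratioS.
  - move=> t k; have /andP[a0 _] := alpha_bounds t.
    by rewrite normrM gtr0_norm// ler_wpM2l ?(ltW a0)//; exact: lnB.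
  - by rewrite -(mul0r B); exact: cvgMr_tmp.
exact: (cvg_belief hN X_cvg cons).
Qed.
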